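(* Let $S$ be a semitopological semigroup. If $LUC(S)$ has a left invariant mean, then $S$ has the following fixed point property: $(G^{\ast})$: Whenever $S$ acts on a nonempty weakly compact convex subset $K$ of a Banach space and the action is jointly weakly continuous and nonexpansive, then $K$ contains a common fixed point for $S$, i.e. an element $x\in K$ with $s\cdot x=x$ for every $s\in S$.
   Context: A semitopological semigroup is a semigroup $S$ with a Hausdorff topology such that for each $t\in S$ the mappings $s\mapsto ts$ and $s\mapsto st$ from $S$ to $S$ are continuous. $\ell^\infty(S)$ is the Banach space of bounded complex-valued functions on $S$ with the supremum norm, and $C(S)$ is its closed subalgebra of bounded continuous functions. For $s\in S$ and $f\in\ell^\infty(S)$, the left translation is $l_sf(t)=f(st)$, $t\in S$. $LUC(S)$ is the space of left uniformly continuous functions, i.e. all $f\in C(S)$ such that the mapping $s\mapsto l_sf$ from $S$ to $C(S)$ is continuous when $C(S)$ has the sup norm topology. A left invariant mean (LIM) on a closed linear translation-invariant subspace $X$ of $\ell^\infty(S)$ containing the constants is a functional $m\in X^*$ with $\|m\|=m(1)=1$ and $m(l_sf)=m(f)$ for all $s\in S$, $f\in X$. An action of $S$ on $K$ (from the left) is a map $S\times K\to K$, $(s,x)\mapsto s\cdot x$, with $s\cdot(s'\cdot x)=(ss')\cdot x$ for all $s,s'\in S$, $x\in K$. For $K$ a subset of a Banach space $E$, the action is: nonexpansive if $\|s\cdot x-s\cdot y\|\le\|x-y\|$ for all $x,y\in K$, $s\in S$; jointly weakly continuous if the map $S\times K\to K$, $(s,x)\mapsto s\cdot x$, is continuous when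 $K$ carries the weak topology of $E$ and $S\times K$ the product topology. *)

(* Defs.v *)
From HB Require Import structures.
From mathcomp Require Import all_boot all_order all_algebra.
From mathcomp Require Import all_classical all_reals all_analysis.
From mathcomp Require Import complex.

Set Implicit Arguments.
Unset Strict Implicit.
Unset Printing Implicit Defensive.

Import Order.TTheory GRing.Theory Num.Theory.
Import numFieldNormedType.Exports.

Local Open Scope classical_set_scope.
Local Open Scope complex_scope.
Local Open Scope ring_scope.

HB.mixin Record isSemitopological S of Topological S & Semigroup S := {
  semitopological_hausdorff : hausdorff_space S;
  mulgl_continuous : forall t : S, continuous (fun s : S => (t * s)%g);
  mulgr_continuous : forall t : S, continuous (fun s : S => (s * t)%g)
}.

#[short(type="semitopologicalSemigroupType")]
HB.structure Definition SemitopologicalSemigroup :=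
  {S of Topological S & Semigroup S & isSemitopological S}.

(* [R[i]^o] is [R[i]] seen as a normed module over itself; this is where the
   library puts the topology of the modulus. *)
Section function_spaces.
Variables (R : realType) (S : semitopologicalSemigroupType).
Implicit Types (f : S -> R[i]^o) (X : set (S -> R[i]^o)).

Definition ltranslate (s : S) f : S -> R[i]^o := fun t => f (s * t)%g.

Definition bounded_continuous : set (S -> R[i]^o) :=
  [set f | bounded_fun f /\ continuous f].

(* [{uniform S -> V}] carries the topology of uniform convergence on [S], that
   is, the sup norm topology on bounded functions. *)
Definition LUC : set (S -> R[i]^o) :=
  [set f | bounded_continuous f /\
           continuous ((fun s => ltranslate s f) : S -> {uniform S -> R[i]^o})].

Definition sup_norm f : \bar R :=
  ereal_sup (range (fun s => (ComplexField.Normc.normc (f s))%:E)).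

Definition linear_on X (m : (S -> R[i]^o) -> R[i]) : Prop :=
  forall (a : R[i]) f g, X f -> X g ->
    m (fun s => a * f s + g s) = a * m f + m g.

Definition dual_norm X (m : (S -> R[i]^o) -> R[i]) : \bar R :=
  ereal_sup [set (ComplexField.Normc.normc (m f))%:E |
             f in X `&` [set f | (sup_norm f <= 1)%E]].

(* A functional on [X] is a function on all of [S -> R[i]] of which only the
   values on [X] matter. Being bounded on [X] is part of [dual_norm X m = 1]. *)
Definition left_invariant_mean X (m : (S -> R[i]^o) -> R[i]) : Prop :=
  [/\ linear_on X m, dual_norm X m = 1%E, m (fun=> 1) = 1 &
      forall s f, X f -> m (ltranslate s f) = m f].

End function_spaces.

Arguments LUC R S : clear implicits.

Section weak_topology.
Variables (F : numFieldType) (E : normedModType F).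

Definition continuous_dual : Type :=
  {phi : {linear E -> F^o} | continuous (phi : E -> F^o)}.

Definition dual_initial (phi : continuous_dual) : Topological E :=
  Topological.class (initial_topology (sval phi : E -> F^o)).

Definition weak : Type := sup_topology dual_initial.

HB.instance Definition _ := Topological.copy weak (sup_topology dual_initial).

End weak_topology.

Section actions.
Variables (S : semitopologicalSemigroupType) (F : numFieldType).
Variables (E : normedModType F) (K : set E).

(* An action on [K] is given by a map [S -> E -> E] of which only the
   restriction to [K] matters. *)
Definition acts_on (act : S -> E -> E) : Prop :=
  (forall s x, K x -> K (act s x)) /\
  (forall s t x, K x -> act s (act t x) = act (s * t)%g x).

Definition nonexpansive (act : S -> E -> E) : Prop :=
  forall s x y, K x -> K y -> `|act s x - act s y| <= `|x - y|.

Definition jointly_weakly_continuous (act : S -> E -> E) : Prop :=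
  {within [set: S] `*` (K : set (weak E)),
    continuous (fun p : S * weak E => act p.1 p.2 : weak E)}.

End actions.

(* The fixed point property, for Banach spaces over the scalar field [F]. *)
Definition fixed_point_property (S : semitopologicalSemigroupType)
    (F : numFieldType) : Prop :=
  forall (E : completeNormedModType F) (K : set E) (act : S -> E -> E),
    K !=set0 -> compact (K : set (weak E)) ->
    convex_set (K : set (convex_lmodType E)) ->
    acts_on K act -> jointly_weakly_continuous K act -> nonexpansive K act ->
    exists2 x, K x & forall s, act s x = x.

(* Main.v *)
Require Import Defs.
From HB Require Import structures.
From mathcomp Require Import all_boot all_order all_algebra.
From mathcomp Require Import all_classical all_reals all_analysis.
From mathcomp Require Import complex.
From mathcomp Require Import ring lra.

Set Implicit Arguments.
Unset Strict Implicit.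
Unset Printing Implicit Defensive.

Import Order.TTheory GRing.Theory Num.Theory.
Import numFieldNormedType.Exports.

Local Open Scope classical_set_scope.
Local Open Scope complex_scope.
Local Open Scope ring_scope.

(** By Zorn's lemma [K] contains a minimal nonempty weakly closed convex
    invariant set [A]; the point is that [A] is a singleton, which is then a
    common fixed point.

    Fix [x0] in [A].  Joint continuity and compactness make [s |-> f (s . x0)]
    left uniformly continuous for every weakly continuous [f] on [A], so the
    invariant mean of [LUC(S)] becomes a positive normalized functional [M] on
    [C(A)] with [M (f o s) = M f] ([orbit_mean]); think of an invariant
    probability measure on [A].  Its energy
      [r u = sup_Phi M (y |-> p_Phi (u - y) ^ 2)],
    where [p_Phi] is the positive part of the maximum of a finite set [Phi] of
    functionals of norm at most 1, plays the role of the integral of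
    [|u - y| ^ 2].  It is convex and weakly lower semicontinuous, and
    nonexpansiveness together with invariance gives [r (s . u) <= r u]
    ([sublevel_act], where Dini's argument compensates for the norm not being
    weakly continuous).  Hence the sublevel sets of [r] are admissible, and by
    minimality [r] is a constant [c] on [A] ([sublevel_minimal]).

    Suppose [c > 0].  Squares are strictly convex, so comparing the energy of a
    barycenter of [u_1, ..., u_n] with the energies of the [u_i] shows that for
    almost every [y] all distances [|u_i - y|] agree and that one and the same
    functional nearly attains all of them ([common_norming_functional],
    [clip_refinement]).  Iterating this on sets of positive mass produces
    points [y_n] of [A] and functionals [f_n] of norm at most 1 with
    [f_n y_i >= f_n y_n + d] for [i < n] and [f_n y_m <= f_n y_n + d / 2] for
    [m >= n].  In a weakly compact set this contradicts Grothendieck's double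
    limit principle ([no_separated_sequence]): a limit functional [g] of the
    [f_n] satisfies [g y_i >= g t + d / 2] for every [i] at a weak cluster
    point [t] of the [y_i].  So [c = 0], and then [A] is a singleton
    ([constant_energy_singleton]).

    Only real functionals below the norm enter, so real and complex spaces are
    treated together: [E] is a real vector space with a seminorm [N], and the
    weak topology lives on a space [T] with a map [e : T -> E] along which the
    functionals below [N] are continuous. *)

(** * Hahn-Banach *)

Section hahn_banach.
Variables (R : realType) (E : lmodType R).
Implicit Types (p q : E -> R) (x y : E).

Definition sublinear q :=
  (forall x y, q (x + y) <= q x + q y) /\
  (forall a x, 0 <= a -> q (a *: x) = a * q x).

Lemma sublinear0 q : sublinear q -> q 0 = 0.
Proof. by move=> [_ /(_ 0 0 (lexx _))]; rewrite scale0r mul0r. Qed.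

Lemma sublinear_ge q x : sublinear q -> - q (- x) <= q x.
Proof.
move=> qs; have [/(_ x (- x)) + _] := qs.
by rewrite subrr (sublinear0 qs); lra.
Qed.

(** The infimum of a chain stays finite because a sublinear [q <= p] satisfies
    [q x >= - q (- x) >= - p (- x)]; it is subadditive because two members of
    the chain can be replaced by the smaller one. *)
Lemma chain_inf_sublinear p (A : set (E -> R)) : A !=set0 ->
  (forall q, A q -> sublinear q /\ forall x, q x <= p x) ->
  (forall q r, A q -> A r -> (forall x, q x <= r x) \/ (forall x, r x <= q x)) ->
  exists2 q, sublinear q & forall r, A r -> forall x, q x <= r x.
Proof.
move=> [q0 Aq0] Asub Atot; pose V x := [set r x | r in A].
have lbV x : has_lbound (V x).
  exists (- p (- x)) => _ [r Ar <-]; have [rs rp] := Asub _ Ar.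
  by apply: le_trans (sublinear_ge x rs); rewrite lerN2.
have V0 x : V x !=set0 by exists (q0 x), q0.
have qle r x : A r -> inf (V x) <= r x.
  by move=> Ar; apply: ge_inf; [exact: lbV|exists r].
exists (fun x => inf (V x)); last by move=> r Ar x; exact: qle.
split=> [x y|a x].
  apply/ler_addgt0Pr => d d0; have d2 : 0 < d / 2 by lra.
  have [_ [r Ar <-] rx] := inf_adherent d2 (conj (V0 x) (lbV x)).
  have [_ [t At <-] ty] := inf_adherent d2 (conj (V0 y) (lbV y)).
  have [rt|tr] := Atot _ _ Ar At.
  - apply: le_trans (qle r _ Ar) _.
    have [[/(_ x y) + _] _] := Asub _ Ar; have := rt y; lra.
  - apply: le_trans (qle t _ At) _.
    have [[/(_ x y) + _] _] := Asub _ At; have := tr x; lra.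
rewrite le_eqVlt => /predU1P[<-|a0].
  rewrite mul0r scale0r; apply/le_anti/andP; split.
    by apply: le_trans (qle _ _ Aq0) _; rewrite (sublinear0 (Asub _ Aq0).1).
  apply: lb_le_inf => // _ [r Ar <-].
  by rewrite (sublinear0 (Asub _ Ar).1).
apply/le_anti/andP; split; last first.
  apply: lb_le_inf => // _ [r Ar <-].
  by rewrite (Asub _ Ar).1.2 ?(ltW a0)// ler_pM2l// qle.
rewrite -ler_pdivrMl//; apply: lb_le_inf => // _ [r Ar <-].
by rewrite ler_pdivrMl// -(Asub _ Ar).1.2 ?(ltW a0)// qle.
Qed.

(** The witness is [r x = inf_(t >= 0) (q (x + t z) - t * q z)].  It lies below
    [q], and [r (- z) <= - q z], so a linear functional below [r] attains [q]
    at [z]. *)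
Lemma sublinear_tilt q z : sublinear q ->
  exists2 r, sublinear r & forall x t, 0 <= t -> r x <= q (x + t *: z) - t * q z.
Proof.
move=> qs; pose V x := [set q (x + t *: z) - t * q z | t in [set t : R | 0 <= t]].
have lbV x : has_lbound (V x).
  exists (- q (- x)) => _ [t /= t0 <-].
  have := qs.1 (x + t *: z) (- x); rewrite addrAC subrr add0r qs.2//; lra.
have V0 x : V x !=set0 by exists (q (x + 0 *: z) - 0 * q z), 0 => //=.
have rle x t : 0 <= t -> inf (V x) <= q (x + t *: z) - t * q z.
  by move=> t0; apply: ge_inf => //; exists t.
have r0 : inf (V 0) = 0.
  apply/le_anti/andP; split.
    apply: le_trans (rle 0 0 (lexx _)) _.
    by rewrite scale0r addr0 (sublinear0 qs); lra.
  apply: lb_le_inf => // _ [t /= t0 <-]; rewrite add0r qs.2//; lra.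
exists (fun x => inf (V x)) => //; split=> [x y|a x].
  apply/ler_addgt0Pr => d d0; have d2 : 0 < d / 2 by lra.
  have [_ [t /= t0 <-] tx] := inf_adherent d2 (conj (V0 x) (lbV x)).
  have [_ [s /= s0 <-] sy] := inf_adherent d2 (conj (V0 y) (lbV y)).
  apply: le_trans (rle (x + y) (t + s) (addr_ge0 t0 s0)) _.
  have := qs.1 (x + t *: z) (y + s *: z).
  rewrite addrACA -scalerDl; lra.
rewrite le_eqVlt => /predU1P[<-|a0]; first by rewrite mul0r scale0r.
apply/le_anti/andP; split; last first.
  apply: lb_le_inf => // _ [t /= t0 <-].
  have -> : a *: x + t *: z = a *: (x + (a^-1 * t) *: z).
    by rewrite scalerDr scalerA mulVKf// gt_eqF.
  have -> : t * q z = a * ((a^-1 * t) * q z) by rewrite !mulrA mulfV ?gt_eqF ?mul1r.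
  rewrite qs.2 ?(ltW a0)// -mulrBr ler_pM2l//; apply: rle.
  by rewrite mulr_ge0// invr_ge0 ltW.
rewrite -ler_pdivrMl//; apply: lb_le_inf => // _ [t /= t0 <-].
rewrite ler_pdivrMl// mulrBr -qs.2 ?(ltW a0)// scalerDr scalerA mulrA.
by apply: rle; rewrite mulr_ge0// ltW.
Qed.

(** Tilting [q] along [z] cannot make it smaller, which says
    [q x + q z <= q (x + z)]; so [q] is additive, hence odd, hence linear. *)
Lemma minimal_sublinear_scalar q : sublinear q ->
  (forall r, sublinear r -> (forall x, r x <= q x) -> r = q) -> scalar q.
Proof.
move=> qs qmin.
have qge x z : q x + q z <= q (x + z).
  have [r rs rle] := sublinear_tilt z qs.
  have <- : r = q.
    apply: qmin => // y; have := rle y 0 (lexx _).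
    by rewrite scale0r addr0 mul0r subr0.
  have := rle x 1 ler01; rewrite scale1r mul1r.
  have rq : r = q.
    apply: qmin => // y; have := rle y 0 (lexx _).
    by rewrite scale0r addr0 mul0r subr0.
  by rewrite rq; lra.
have qD x z : q (x + z) = q x + q z.
  by apply/le_anti; rewrite qge qs.1.
have qN x : q (- x) = - q x.
  by apply/eqP; rewrite -subr_eq0 opprK -qD addNr (sublinear0 qs).
move=> a x y; rewrite qD; congr (_ + _).
have [a0|a0] := leP 0 a; first exact: qs.2.
have := qs.2 (- a) x; rewrite oppr_ge0 ltW// scaleNr qN mulNr.
by move=> /(_ isT) /oppr_inj.
Qed.

(** Zorn's lemma provides a minimal sublinear functional below [p], and that one
    is linear. *)
Lemma sublinear_dominates p : sublinear p ->
  exists2 f, scalar f & forall x, f x <= p x.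
Proof.
move=> ps; pose X := {q : E -> R | sublinear q /\ forall x, q x <= p x}.
pose rR (q r : X) := `[< forall x, sval r x <= sval q x >].
have [| | | |q qmin] := @Zorn X rR.
- by move=> q; apply/asboolP.
- move=> q r s /asboolP qr /asboolP rs; apply/asboolP => x.
  exact: le_trans (rs x) (qr x).
- move=> [q qP] [r rP] /asboolP /= qr /asboolP /= rq; apply: eq_exist.
  by apply/funext => x; apply/le_anti; rewrite qr rq.
- move=> A Atot; have [[q0 Aq0]|A0] := pselect (A !=set0); last first.
    exists (exist _ p (conj ps (fun=> lexx _))) => s As.
    by case: A0; exists s.
  have [|||q qs qle] := @chain_inf_sublinear p [set sval q | q in A].
  + by exists (sval q0), q0.
  + by move=> _ [q Aq <-]; exact: (svalP q).
  + move=> _ _ [q Aq <-] [r Ar <-].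
    by have [/asboolP qr|/asboolP rq] := Atot _ _ Aq Ar; [right|left].
  + have qp x : q x <= p x.
      apply: le_trans (qle (sval q0) _ x) ((svalP q0).2 x).
      by exists q0.
    exists (exist _ q (conj qs qp)) => s As; apply/asboolP => x /=.
    by apply: qle; exists s.
- case: q => q [qs qp] in qmin *; exists q => //.
  apply: minimal_sublinear_scalar => // r rs rq.
  have rp x : r x <= p x by exact: le_trans (rq x) (qp x).
  have : rR (exist _ q (conj qs qp)) (exist _ r (conj rs rp)) by apply/asboolP.
  by move=> /qmin [].
Qed.

Definition seminorm p :=
  (forall x y, p (x + y) <= p x + p y) /\ (forall a x, p (a *: x) = `|a| * p x).

(** For a norm [p] this is the unit ball of the real dual. *)
Definition dual_ball p : set (E -> R) :=
  [set f | scalar f /\ forall x, f x <= p x].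

Lemma seminorm_sublinear p : seminorm p -> sublinear p.
Proof. by move=> [pD pZ]; split=> // a x a0; rewrite pZ ger0_norm. Qed.

Lemma norming p x : seminorm p -> exists2 f, dual_ball p f & f x = p x.
Proof.
move=> pn; have ps := seminorm_sublinear pn.
have [r rs rle] := sublinear_tilt x ps.
have [f fs fr] := sublinear_dominates rs.
have fp y : f y <= p y.
  apply: le_trans (fr y) _; have := rle y 0 (lexx _).
  by rewrite scale0r addr0 mul0r subr0.
exists f => //; apply/le_anti/andP; split; first exact: fp.
have fN : f (- x) = - f x.
  have := fs (-1) x 0; rewrite scaleN1r !addr0 => ->.
  have := fs (-1) 0 0; rewrite scaler0 addr0; lra.
have := fr (- x); have := rle (- x) 1 ler01.
rewrite scale1r addNr (sublinear0 ps) fN; lra.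
Qed.

Lemma dual_ballN p f x : dual_ball p f -> f (- x) = - f x.
Proof.
move=> [fs _]; have := fs (-1) 0 0; rewrite scaler0 addr0.
by have := fs (-1) x 0; rewrite scaleN1r !addr0 => ->; lra.
Qed.

Lemma dual_ballD p f x y : dual_ball p f -> f (x + y) = f x + f y.
Proof. by move=> [fs _]; have := fs 1 x y; rewrite scale1r mul1r. Qed.

Lemma dual_ballB p f x y : dual_ball p f -> f (x - y) = f x - f y.
Proof. by move=> pf; rewrite (dual_ballD _ _ pf) (dual_ballN _ pf). Qed.

Lemma dual_ballZ p f a x : dual_ball p f -> f (a *: x) = a * f x.
Proof.
move=> pf; have := pf.1 a x (x - x).
by rewrite (dual_ballB _ _ pf) !subrr !addr0.
Qed.

Lemma dual_ball_ge p f x : dual_ball p f -> - p (- x) <= f x.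
Proof. by move=> pf; rewrite lerNl -(dual_ballN _ pf); exact: pf.2. Qed.

(** A limit of a sequence of the dual ball that keeps all eventual lower bounds,
    as a weak-star cluster point would.  It is a linear functional below the
    sublinear functional [x |-> limsup_n f n x]. *)
Lemma dual_ball_limit p (f : nat -> E -> R) : seminorm p ->
  (forall n, dual_ball p (f n)) ->
  exists2 g, dual_ball p g &
    forall x c, (\forall n \near \oo, c <= f n x) -> c <= g x.
Proof.
move=> pn fp; have ps := seminorm_sublinear pn.
pose V x := [set c | \forall n \near \oo, f n x <= c].
have Vp x : V x (p x) by apply: nearW => n; exact: (fp n).2.
have V0 x : V x !=set0 by exists (p x).
have lbV x : has_lbound (V x).
  exists (- p (- x)) => c /= Vc; have [n /= fnc] := filter_ex Vc.
  exact: le_trans (dual_ball_ge x (fp n)) fnc.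
have infle x c : V x c -> inf (V x) <= c by move=> Vc; exact: ge_inf.
have V00 : inf (V 0) = 0.
  apply/le_anti/andP; split.
    by apply: le_trans (infle _ _ (Vp 0)) _; rewrite (sublinear0 ps).
  apply: lb_le_inf => // c Vc; have [n /= fnc] := filter_ex Vc.
  by have := (fp n).1 (-1) 0 0; rewrite scaler0 addr0; lra.
have qZ a x : 0 < a -> inf (V (a *: x)) <= a * inf (V x).
  move=> a0; rewrite -ler_pdivrMl//; apply: lb_le_inf => // c Vc.
  rewrite ler_pdivrMl//; apply: infle; apply: filterS Vc => n.
  by rewrite (dual_ballZ _ _ (fp n)) ler_pM2l.
have [|g gs gle] := @sublinear_dominates (fun x => inf (V x)).
  split=> [x y|a x].
    apply/ler_addgt0Pr => d d0; have d2 : 0 < d / 2 by lra.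
    have [c Vc cx] := inf_adherent d2 (conj (V0 x) (lbV x)).
    have [c' Vc' cy] := inf_adherent d2 (conj (V0 y) (lbV y)).
    suff : inf (V (x + y)) <= c + c' by lra.
    apply: infle; rewrite /V /=; near=> n; rewrite (dual_ballD _ _ (fp n)).
    by apply: lerD; near: n.
  rewrite le_eqVlt => /predU1P[<-|a0]; first by rewrite mul0r scale0r.
  apply/le_anti; rewrite qZ//= -ler_pdivlMl//.
  have := qZ a^-1 (a *: x); rewrite invr_gt0 scalerA mulVf ?gt_eqF// scale1r.
  exact.
have gp : dual_ball p g by split => // x; exact: le_trans (gle x) (infle _ _ (Vp x)).
exists g => // x c cf; rewrite -[c]opprK lerNl -(dual_ballN _ gp).
apply: le_trans (gle _) _; apply: infle; apply: filterS cf => n.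
by rewrite (dual_ballN _ (fp n)) lerN2.
Unshelve. all: by end_near. Qed.

End hahn_banach.

(** * Functionals on compact sets *)

Section compact_real.
Variables (R : realType) (T : topologicalType).
Implicit Types (K : set T) (f : T -> R).

Lemma within_continuous_bounded K f : compact K -> {within K, continuous f} ->
  exists2 C, 0 < C & forall x, K x -> `|f x| <= C.
Proof.
move=> cK fK; have /compact_bounded := continuous_compact fK cK.
move=> /(@pinfty_ex_gt0 R) [C C0 fC]; exists C => // x Kx.
by apply: fC; exists x.
Qed.

Lemma cluster_le (F : set_system T) f t c :
  cluster F t -> {for t, continuous f} -> F [set x | f x <= c] -> f t <= c.
Proof.
move=> Ft ft Fc; rewrite leNgt; apply/negP => tc.
have : nbhs t [set x | c < f x] by exact: (ft _ (lt_nbhsr tc)).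
by move=> /(Ft _ _ Fc) [x [/= xc cx]]; lra.
Qed.

Lemma cluster_ge (F : set_system T) {FF : Filter F} f t c :
  cluster F t -> {for t, continuous f} -> F [set x | c <= f x] -> c <= f t.
Proof.
move=> Ft ft Fc; rewrite -lerN2; apply: (cluster_le (f := fun x => - f x) Ft).
  by apply: continuousN.
by apply: filterS Fc => x /=; rewrite lerN2.
Qed.

End compact_real.

Section weakly_compact.
Variables (R : realType) (E : lmodType R) (N : E -> R).
Variables (T : topologicalType) (e : T -> E) (K : set T).
Hypothesis Nnorm : seminorm N.
Hypothesis ballC : forall f, dual_ball N f -> continuous (f \o e).
Hypothesis Kcompact : compact K.

Lemma compact_sequence_cluster (y : nat -> T) : (forall n, K (y n)) ->
  exists2 t, K t & cluster (y @ \oo) t.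
Proof.
move=> Ky; have [|t [Kt yt]] := @Kcompact (y @ \oo) _; last by exists t.
by exists 0%N => // n _ /=; exact: Ky.
Qed.

(** The double limit principle.  Let [t] be a cluster point of [y], so that
    [f n (e t) <= f n (e (y n)) + d / 2] for all [n].  A limit [g] of the [f n]
    then satisfies [g (e t) + d / 2 <= g (e (y i))] for all [i], which is
    incompatible with [t] being a cluster point of [y]. *)
Lemma no_separated_sequence (y : nat -> T) (f : nat -> E -> R) (d : R) :
  0 < d -> (forall n, K (y n)) -> (forall n, dual_ball N (f n)) ->
  (forall i n, (i < n)%N -> f n (e (y n)) + d <= f n (e (y i))) ->
  (forall n m, (n <= m)%N -> f n (e (y m)) <= f n (e (y n)) + d / 2) -> False.
Proof.
move=> d0 Ky fN fge fle; have [t Kt yt] := compact_sequence_cluster Ky.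
have ft n : f n (e t) <= f n (e (y n)) + d / 2.
  apply: (cluster_le (f := f n \o e) yt); first exact: ballC.
  by exists n => // m /= nm; exact: fle.
have [g gN gge] := dual_ball_limit Nnorm fN.
have gy i : g (e t) + d / 2 <= g (e (y i)).
  suff : d / 2 <= g (e (y i) - e t) by rewrite (dual_ballB _ _ gN); lra.
  apply: gge; exists i.+1 => // n /= ni; rewrite (dual_ballB _ _ (fN n)).
  have := ft n; have := fge _ _ ni; lra.
have : g (e t) + d / 2 <= g (e t).
  apply: (cluster_ge (f := g \o e) yt); first exact: ballC.
  by exists 0%N => // n _ /=; exact: gy.
lra.
Qed.

Lemma dual_ball_bounded f : dual_ball N f ->
  exists2 C, 0 < C & forall x, K x -> `|f (e x)| <= C.
Proof.
move=> fN; apply: (within_continuous_bounded (f := f \o e)) Kcompact _.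
exact/continuous_subspaceT/ballC.
Qed.

(** Convexity of the image of [K] under [e]. *)
Definition convex_along := forall u v t, K u -> K v -> 0 <= t <= 1 ->
  exists2 w, K w & e w = t *: e u + (1 - t) *: e v.

Hypothesis Kconvex : convex_along.

(** [W] contains an initial piece, of uniform length, of every segment from a
    point of [K `&` W] to a point of [K]. *)
Let core (W : set T) := forall y, K y -> W y -> exists2 l, 0 < l &
  forall s z w, 0 <= s <= l -> K z -> K w ->
    e w = s *: e z + (1 - s) *: e y -> W w.

(** A uniform boundedness principle by a Baire argument inside [K].  If [K] is
    unbounded, then moving a point slightly towards a point of huge norm stays
    in any given finite intersection of half-spaces [n < f] but makes the norm
    large; so functionals [f_n] below [N] can be chosen one after the other such
    that for every [n] some point of [K] satisfies [f_0 > 0], ..., [f_n > n].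
    A cluster point of these points would have infinite norm. *)
Lemma weakly_compact_bounded : exists C, forall x, K x -> N (e x) <= C.
Proof.
apply: contrapT => unb.
have {}unb C : exists2 x, K x & C < N (e x).
  apply: contrapT => nx; apply: unb; exists C => x Kx.
  by rewrite leNgt; apply/negP => xC; apply: nx; exists x.
pose good W := core W /\ K `&` W !=set0.
have step n W : exists f, good W -> dual_ball N f /\
    good (W `&` [set x | n%:R < f (e x)]).
  have [[Wcore [y [Ky Wy]]]|nW] := pselect (good W); last by exists (fun=> 0).
  have [l l0 lW] := Wcore _ Ky Wy.
  pose s := Num.min l 1; have s0 : 0 < s by rewrite lt_min l0 ltr01.
  have sl : s <= l by rewrite ge_min lexx.
  have s1 : s <= 1 by rewrite ge_min lexx orbT.
  have [z Kz zC] := unb (s^-1 * (n%:R + N ((s - 1) *: e y))).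
  have s01 : 0 <= s <= 1 by rewrite (ltW s0).
  have [w Kw wE] := Kconvex Kz Ky s01.
  have Ww : W w by apply: lW Kz Kw wE; rewrite (ltW s0).
  have [f fN fw] := norming (e w) Nnorm; exists f => _; split => //.
  split; last first.
    exists w; split => //; split => //=; rewrite fw.
    have : N (s *: e z) <= N (e w) + N ((s - 1) *: e y).
      apply: le_trans (Nnorm.1 _ _); rewrite wE -addrA -scalerDl.
      by rewrite [1 - s + _]addrA subrK subrr scale0r addr0.
    rewrite (Nnorm.2 s) gtr0_norm//; move: zC; rewrite ltr_pdivrMl//; lra.
  move=> x Kx [Wx /= nx]; have [m m0 mW] := Wcore _ Kx Wx.
  have [C C0 fC] := dual_ball_bounded fN.
  pose D := (f (e x) - n%:R) / (2 * C + 1).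
  have D0 : 0 < D by rewrite divr_gt0//; lra.
  exists (Num.min m D); first by rewrite lt_min m0.
  move=> t a b; rewrite le_min => /andP[t0 /andP[tm tD]] Ka Kb bE; split => /=.
    by apply: mW Ka Kb bE; rewrite t0.
  rewrite bE (dual_ballD _ _ fN) !(dual_ballZ _ _ fN).
  have : t * (2 * C + 1) <= f (e x) - n%:R by rewrite -ler_pdivlMr//; lra.
  have : t * (f (e x) - f (e a)) <= t * (2 * C).
    apply: ler_wpM2l => //; have := fC _ Kx; have := fC _ Ka.
    by rewrite !ler_norml; lra.
  have [->|/eqP tn0] := eqVneq t 0; first lra.
  have : 0 < t by rewrite lt_neqAle t0 andbT eq_sym; exact/eqP.
  lra.
have [F FP] := choice (fun p : nat * set T => step p.1 p.2).
pose W := fix W n := if n is n'.+1 then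
  W n' `&` [set x | n'%:R < F (n', W n') (e x)] else setT.
have Wgood n : good (W n).
  elim: n => [|n IH] /=; last exact: (FP (n, W n) IH).2.
  split; first by move=> *; exists 1.
  by have [x Kx _] := unb 0; exists x.
have /choice[y yP] n : exists x, K x /\ W n x by have [_ [x []]] := Wgood n; exists x.
have [t Kt yt] := compact_sequence_cluster (fun n => (yP n).1).
have Wmon n m : (n <= m)%N -> W m `<=` W n.
  move=> /subnK <-; elim: (m - n)%N => //= k IH x [+ _]; exact: IH.
pose f n := F (n, W n).
have fN n : dual_ball N (f n) by exact: (FP (n, W n) (Wgood n)).1.
have fge n : n%:R <= N (e t).
  apply: le_trans (_ : f n (e t) <= _); last exact: (fN n).2.
  apply: (cluster_ge (f := f n \o e) yt); first exact: ballC.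
  exists n.+1 => // m /= nm; have [_ /=] := Wmon _ _ nm _ (yP m).2.
  exact: ltW.
have := fge (Num.truncn (N (e t))).+1.
by rewrite leNgt truncnS_gt.
Qed.

End weakly_compact.

(** * From a mean on LUC functions to a mean on an orbit *)

Section orbit_mean.
Variables (R : realType) (S : semitopologicalSemigroupType).
Variables (T : topologicalType) (K : set T).
Implicit Types (f g : T -> R).

(** As only values on [K] matter, [M] is defined on all functions on [T]. *)
Definition mean_on (M : (T -> R) -> R) :=
  [/\ forall a f g, {within K, continuous f} -> {within K, continuous g} ->
        M (fun x => a * f x + g x) = a * M f + M g,
      forall f, {within K, continuous f} -> (forall x, K x -> 0 <= f x) ->
        0 <= M f &
      M (fun=> 1) = 1].

Variable act : S -> T -> T.
Hypothesis Kcompact : compact K.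
Hypothesis actK : forall s x, K x -> K (act s x).
Hypothesis actA : forall s t x, K x -> act s (act t x) = act (s * t)%g x.
Hypothesis actC : {within [set: S] `*` K, continuous (fun p => act p.1 p.2)}.

Lemma comp_act_continuous f : {within K, continuous f} ->
  {within [set: S] `*` K, continuous (fun p => f (act p.1 p.2))}.
Proof.
move=> /subspace_continuousP fK; apply/subspace_continuousP => -[s x] [_ /= Kx].
have /subspace_continuousP /(_ (s, x) (conj I Kx)) acts := actC.
move=> W /(fK _ (actK s Kx)) /acts /=.
rewrite /nbhs /= /within /=; apply: filterS => -[t y] /= + [_ Ky].
by apply; [split|exact: actK].
Qed.

Lemma comp_act_within f s : {within K, continuous f} ->
  {within K, continuous (f \o act s)}.
Proof.
move=> /comp_act_continuous /subspace_continuousP fact.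
apply/subspace_continuousP => x Kx W /(fact (s, x) (conj I Kx)).
rewrite /nbhs /= /within /= => -[[U V] /= [sU xV] UV].
apply: filterS xV => y Vy Ky; apply: (UV (s, y)); split => //=.
exact: nbhs_singleton.
Qed.

(** This is where joint continuity is used: with separate continuity the orbit
    functions below would be continuous, but possibly not in LUC. *)
Lemma comp_act_equicontinuous f s0 (eps : R) :
  {within K, continuous f} -> 0 < eps ->
  \forall s \near s0, forall y, K y -> `|f (act s0 y) - f (act s y)| < eps.
Proof.
move=> fK eps0.
have cK : near_covering_within K.
  exact/near_covering_withinP/compact_near_coveringP.
apply: (cK _ _ (fun s y => `|f (act s0 y) - f (act s y)| < eps)) => x Kx.
have /subspace_continuousP /(_ (s0, x) (conj I Kx)) := comp_act_continuous fK.
move=> /cvgrPdist_lt /(_ (eps / 2)); rewrite divr_gt0// => /(_ isT).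
rewrite /within /= => -[[U V] /= [sU xV] UV].
exists (V, U) => //= -[y s] /= [Vy Us] Ky.
have := UV (s, y) (conj Us Vy) (conj I Ky).
have := UV (s0, y) (conj (nbhs_singleton sU) Vy) (conj I Ky) => /=.
rewrite /from_subspace /= !ltr_norml; lra.
Qed.

Definition orbit_fun (x0 : T) f : S -> R[i]^o := fun s => (f (act s x0))%:C.

Lemma normC_real (a : R) : `|a%:C| = `|a|%:C.
Proof. by rewrite normc_def /= expr0n/= addr0 sqrtr_sqr. Qed.

Lemma orbit_fun_LUC x0 f : K x0 -> {within K, continuous f} ->
  LUC R S (orbit_fun x0 f).
Proof.
move=> Kx0 fK.
have key s0 (eps : R[i]) : 0 < eps -> \forall s \near s0, forall t,
    `|orbit_fun x0 f (s0 * t)%g - orbit_fun x0 f (s * t)%g| < eps.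
  case: eps => e1 e2; rewrite ltcE /= => /andP[/eqP -> e10].
  have := comp_act_equicontinuous s0 fK e10; apply: filterS => s fs t.
  rewrite /orbit_fun -!actA// -rmorphB normC_real ltcR.
  exact/fs/actK.
split; last first.
  move=> s0 W; rewrite /= uniform_nbhs => -[A [eA AW]].
  move: eA; rewrite -entourage_ballE => -[eps /= eps0 epsA].
  apply: (filterS _ (key s0 _ eps0)) => s sP.
  by apply: AW => t _; apply: epsA => /=; rewrite -ball_normE; exact: sP.
split.
  have [C C0 fC] := within_continuous_bounded Kcompact fK.
  exists (C%:C : R[i]); split; first by rewrite realE ler0c ltW.
  move=> B CB s _ /=; apply: le_trans (ltW CB).
  by rewrite /orbit_fun normC_real lecR; apply/fC/actK.
move=> s0; apply/cvgrPdist_lt => -[e1 e2]; rewrite ltcE /= => /andP[/eqP -> e10].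
have := comp_act_equicontinuous s0 fK e10; apply: filterS => s fs.
by rewrite /orbit_fun -rmorphB normC_real ltcR; exact: fs.
Qed.

(** [M f] is the real part of the mean of the orbit function of [f] at a point of
    [K].  Positivity of [M] comes from norm one: if [0 <= f <= C] then
    [1 - f / C] has norm at most 1, so its mean has real part at most 1. *)
Lemma orbit_mean : (exists m, left_invariant_mean (LUC R S) m) -> K !=set0 ->
  exists2 M, mean_on M &
    forall s f, {within K, continuous f} -> M (f \o act s) = M f.
Proof.
move=> [m [mlin mnorm m1 minv]] [x0 Kx0].
have orbL := orbit_fun_LUC Kx0.
pose M f := complex.Re (m (orbit_fun x0 f)).
have Mlin a f g : {within K, continuous f} -> {within K, continuous g} ->
    M (fun x => a * f x + g x) = a * M f + M g.
  move=> fK gK; rewrite /M.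
  have -> : orbit_fun x0 (fun x => a * f x + g x) =
      (fun s => a%:C * orbit_fun x0 f s + orbit_fun x0 g s).
    by apply/funext => s; rewrite /orbit_fun rmorphD rmorphM.
  rewrite mlin//; [|exact: orbL|exact: orbL].
  by case: (m _) => u v; case: (m _) => u' v' /=; rewrite mul0r subr0.
have M1 : M (fun=> 1) = 1 by rewrite /M (_ : orbit_fun _ _ = fun=> 1)// m1.
have Mle1 f : {within K, continuous f} -> (forall x, K x -> `|f x| <= 1) ->
    M f <= 1.
  move=> fK f1.
  have : ((ComplexField.Normc.normc (m (orbit_fun x0 f)))%:E <= 1)%E.
    rewrite -mnorm; apply: ereal_sup_ubound; exists (orbit_fun x0 f) => //.
    split; first exact: orbL.
    apply: ge_ereal_sup => _ [s _ <-]; rewrite lee_fin /=.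
    by rewrite expr0n addr0 sqrtr_sqr; apply/f1/actK.
  rewrite lee_fin /M; case: (m _) => u v /=; apply: le_trans.
  apply: le_trans (ler_norm u) _; rewrite -sqrtr_sqr ler_wsqrtr//.
  by rewrite lerDl sqr_ge0.
exists M; last first.
  move=> s f fK; rewrite /M -[in RHS](minv s); last exact: orbL.
  congr (complex.Re (m _)); apply/funext => t.
  by rewrite /ltranslate /orbit_fun /= actA.
split => // f fK f0.
have [C C0 fC] := within_continuous_bounded Kcompact fK.
have C1K : {within K, continuous (fun=> 1 : R)}.
  exact/continuous_subspaceT/cst_continuous.
have := Mlin (- C^-1) f (fun=> 1) fK C1K; rewrite M1 => MC.
suff : - C^-1 * M f + 1 <= 1.
  by rewrite gerDr mulNr oppr_le0 pmulr_rge0// invr_gt0.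
rewrite -MC; apply: Mle1.
  apply/subspace_continuousP => x Kx; apply: cvgD; last exact: cvg_cst.
  by apply: cvgM; [exact: cvg_cst|move/subspace_continuousP : fK; exact].
move=> x Kx; have := fC _ Kx; have := f0 _ Kx; move=> fx0; rewrite ger0_norm// => fxC.
have : 0 <= C^-1 * f x <= 1.
  by rewrite mulr_ge0 ?invr_ge0 ?(ltW C0)//= ler_pdivrMl// mulr1.
by rewrite ler_norml; lra.
Qed.

End orbit_mean.

(** * Means on continuous functions and finite suprema of functionals *)

Section continuous_real.
Variables (R : realType) (X : topologicalType).
Implicit Types f g : X -> R.

Lemma continuous_addr f g : continuous f -> continuous g ->
  continuous (fun x => f x + g x).
Proof. by move=> fc gc x; apply: cvgD; [exact: fc|exact: gc]. Qed.

Lemma continuous_subr f g : continuous f -> continuous g ->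
  continuous (fun x => f x - g x).
Proof. by move=> fc gc x; apply: cvgB; [exact: fc|exact: gc]. Qed.

Lemma continuous_mulr f g : continuous f -> continuous g ->
  continuous (fun x => f x * g x).
Proof. by move=> fc gc x; apply: cvgM; [exact: fc|exact: gc]. Qed.

Lemma continuous_maxr f g : continuous f -> continuous g ->
  continuous (fun x => Num.max (f x) (g x)).
Proof.
move=> fc gc; under eq_fun do rewrite maxr_absE.
apply: continuous_mulr; last exact: cst_continuous.
apply: continuous_addr; first exact: continuous_addr.
by move=> x; apply: cvg_norm; apply: cvgB; [exact: fc|exact: gc].
Qed.

Lemma continuous_sumr (I : eqType) (r : seq I) (h : I -> X -> R) :
  {in r, forall i, continuous (h i)} ->
  continuous (fun x => \sum_(i <- r) h i x).
Proof.
elim: r => [|i r IH] hc.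
  by under eq_fun do rewrite big_nil; exact: cst_continuous.
under eq_fun do rewrite big_cons; apply: continuous_addr.
  by apply: hc; rewrite mem_head.
by apply: IH => j jr; apply: hc; rewrite inE jr orbT.
Qed.

Lemma continuous_prodr (I : eqType) (r : seq I) (h : I -> X -> R) :
  {in r, forall i, continuous (h i)} ->
  continuous (fun x => \prod_(i <- r) h i x).
Proof.
elim: r => [|i r IH] hc.
  by under eq_fun do rewrite big_nil; exact: cst_continuous.
under eq_fun do rewrite big_cons; apply: continuous_mulr.
  by apply: hc; rewrite mem_head.
by apply: IH => j jr; apply: hc; rewrite inE jr orbT.
Qed.

End continuous_real.

Section mean_theory.
Variables (R : realType) (T : topologicalType) (K : set T).
Variable M : (T -> R) -> R.
Hypothesis Mmean : mean_on K M.
Implicit Types f g : T -> R.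

Local Notation "'KC' f" := ({within K, continuous f}) (at level 10).

Lemma within_continuousT f : continuous f -> KC f.
Proof. exact: continuous_subspaceT. Qed.

Lemma within_continuous_cst (c : R) : KC (fun=> c).
Proof. exact/within_continuousT/cst_continuous. Qed.

Lemma within_continuous_lin a f g : KC f -> KC g -> KC (fun x => a * f x + g x).
Proof.
move=> fK gK; apply: (@continuous_addr R (subspace K)) => //.
by apply: (@continuous_mulr R (subspace K)) => //; exact: cst_continuous.
Qed.

Lemma mean_lin a f g : KC f -> KC g ->
  M (fun x => a * f x + g x) = a * M f + M g.
Proof. by case: Mmean => + _ _; exact. Qed.

Lemma mean_ge0 f : KC f -> (forall x, K x -> 0 <= f x) -> 0 <= M f.
Proof. by case: Mmean => _ + _; exact. Qed.

Lemma mean_le f g : KC f -> KC g -> (forall x, K x -> f x <= g x) -> M f <= M g.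
Proof.
move=> fK gK fg; have := mean_lin (-1) fK gK; rewrite mulN1r => E.
suff : 0 <= - M f + M g by lra.
rewrite -E; apply: mean_ge0; first exact: within_continuous_lin.
by move=> x Kx; have := fg _ Kx; lra.
Qed.

Lemma mean0 : M (fun=> 0) = 0.
Proof.
have := mean_lin 1 (@within_continuous_cst 0) (@within_continuous_cst 0).
rewrite (_ : (fun x : T => 1 * 0 + 0) = fun=> 0); last by apply/funext => x; lra.
lra.
Qed.

Lemma meanD f g : KC f -> KC g -> M (fun x => f x + g x) = M f + M g.
Proof.
move=> fK gK; have := mean_lin 1 fK gK; rewrite mul1r => <-.
by congr M; apply/funext => x; rewrite mul1r.
Qed.

Lemma meanZ a f : KC f -> M (fun x => a * f x) = a * M f.
Proof.
move=> fK; have := mean_lin a fK (@within_continuous_cst 0); rewrite mean0 addr0 => <-.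
by congr M; apply/funext => x; rewrite addr0.
Qed.

Lemma mean_cst c : M (fun=> c) = c.
Proof.
case: Mmean => _ _ M1; rewrite -[RHS]mulr1 -M1 -meanZ; last exact: within_continuous_cst.
by congr M; apply/funext => x; rewrite mulr1.
Qed.

Lemma within_continuous_sum (I : eqType) (r : seq I) (h : I -> T -> R) :
  {in r, forall i, KC (h i)} -> KC (fun x => \sum_(i <- r) h i x).
Proof. exact: (@continuous_sumr R (subspace K)). Qed.

Lemma mean_sum (I : eqType) (r : seq I) (h : I -> T -> R) :
  {in r, forall i, KC (h i)} ->
  M (fun x => \sum_(i <- r) h i x) = \sum_(i <- r) M (h i).
Proof.
elim: r => [|i r IH] hK.
  by rewrite big_nil; under eq_fun do rewrite big_nil; exact: mean0.
have hr : {in r, forall i, KC (h i)}.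
  by move=> j jr; apply: hK; rewrite inE jr orbT.
rewrite big_cons -IH//; under eq_fun do rewrite big_cons.
by rewrite meanD//; [apply: hK; rewrite mem_head|exact: within_continuous_sum].
Qed.

Lemma mean_sum_gt0 (I : eqType) (r : seq I) (h : I -> T -> R) :
  {in r, forall i, KC (h i)} ->
  0 < M (fun x => \sum_(i <- r) h i x) -> exists2 i, i \in r & 0 < M (h i).
Proof.
move=> hK; rewrite mean_sum// => h0; apply: contrapT => nh.
move: h0; rewrite ltNge => /negP; apply.
rewrite big_seq; apply: sumr_le0 => i ir; rewrite leNgt; apply/negP => hi.
by apply: nh; exists i.
Qed.

Lemma mean_gt0_ex f : KC f -> 0 < M f -> exists2 x, K x & 0 < f x.
Proof.
move=> fK f0; apply: contrapT => nf.
have : M f <= M (fun=> 0).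
  apply: mean_le => //; first exact: within_continuous_cst.
  by move=> x Kx; rewrite leNgt; apply/negP => fx; apply: nf; exists x.
by rewrite mean0; lra.
Qed.

End mean_theory.

Section finite_sup.
Variables (R : realType) (E : lmodType R) (N : E -> R).
Hypothesis Nnorm : seminorm N.
Implicit Types (Phi Psi : seq (E -> R)) (x y : E).

Definition fsup Phi x := \big[Num.max/0]_(f <- Phi) f x.

Definition in_ball Phi := {in Phi, forall f, dual_ball N f}.

Lemma seminorm_ge0 x : 0 <= N x.
Proof.
have := Nnorm.1 x (- x); rewrite subrr -scaleN1r Nnorm.2 normrN1 mul1r.
by rewrite (sublinear0 (seminorm_sublinear Nnorm)); lra.
Qed.

Lemma seminormN x : N (- x) = N x.
Proof. by rewrite -scaleN1r Nnorm.2 normrN1 mul1r. Qed.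

Lemma fsup_ge0 Phi x : 0 <= fsup Phi x.
Proof.
by rewrite /fsup; elim: Phi => [|f r IH]; rewrite ?big_nil// big_cons le_max IH orbT.
Qed.

Lemma fsup_ge Phi f x : f \in Phi -> f x <= fsup Phi x.
Proof.
rewrite /fsup; elim: Phi => // g r IH; rewrite inE big_cons le_max.
by move=> /orP[/eqP <-|/IH ->]; rewrite ?lexx// orbT.
Qed.

Lemma fsup_le Phi x c : 0 <= c -> {in Phi, forall f, f x <= c} ->
  fsup Phi x <= c.
Proof.
move=> c0; rewrite /fsup; elim: Phi => [|f r IH] fc; first by rewrite big_nil.
rewrite big_cons ge_max fc ?mem_head//= IH// => g gr.
by apply: fc; rewrite inE gr orbT.
Qed.

Lemma fsup_attained Phi x : 0 < fsup Phi x ->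
  exists2 f, f \in Phi & f x = fsup Phi x.
Proof.
rewrite /fsup; elim: Phi => [|f r IH]; first by rewrite big_nil ltxx.
rewrite big_cons; have [fr|fr] := leP (f x) (\big[Num.max/0]_(g <- r) g x).
  by move=> /IH [g gr gx]; exists g => //; rewrite inE gr orbT.
by move=> _; exists f => //; rewrite mem_head.
Qed.

Lemma fsup_le_norm Phi x : in_ball Phi -> fsup Phi x <= N x.
Proof. by move=> PN; apply: fsup_le (seminorm_ge0 x) _ => f /PN []. Qed.

Lemma fsup_sub Phi Psi x : {subset Phi <= Psi} -> fsup Phi x <= fsup Psi x.
Proof.
by move=> PP; apply: fsup_le (fsup_ge0 _ _) _ => f /PP fPsi; exact: fsup_ge.
Qed.

Lemma fsup_sublinear Phi : in_ball Phi -> sublinear (fsup Phi).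
Proof.
move=> PN; split=> [x y|a x].
  apply: fsup_le => [|f fP]; first by rewrite addr_ge0 ?fsup_ge0.
  by rewrite (dual_ballD _ _ (PN _ fP)) lerD ?fsup_ge.
rewrite le_eqVlt => /predU1P[<-|a0].
  rewrite scale0r mul0r; apply/le_anti; rewrite fsup_ge0 andbT.
  apply: fsup_le => // f fP.
  by rewrite -[0 : E](scale0r 0) (dual_ballZ _ _ (PN _ fP)) mul0r.
apply/le_anti/andP; split.
  apply: fsup_le => [|f fP]; first by rewrite mulr_ge0 ?fsup_ge0 ?ltW.
  by rewrite (dual_ballZ _ _ (PN _ fP)) ler_pM2l// fsup_ge.
rewrite -ler_pdivlMl//; apply: fsup_le => [|f fP].
  by rewrite mulr_ge0 ?fsup_ge0// invr_ge0 ltW.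
rewrite ler_pdivlMl// -(dual_ballZ _ _ (PN _ fP)); exact: fsup_ge.
Qed.

Lemma fsup_continuous (X : topologicalType) (h : X -> E) Phi :
  {in Phi, forall f, continuous (f \o h)} -> continuous (fsup Phi \o h).
Proof.
rewrite /fsup /comp; elim: Phi => [|f r IH] hc.
  by under eq_fun do rewrite big_nil; exact: cst_continuous.
under eq_fun do rewrite big_cons; apply: continuous_maxr.
  by apply: hc; rewrite mem_head.
by apply: IH => g gr; apply: hc; rewrite inE gr orbT.
Qed.

End finite_sup.

(** * Sets on which the energy is constant *)

Section constant_energy.
Variables (R : realType) (E : lmodType R) (N : E -> R).
Variables (T : topologicalType) (e : T -> E) (K : set T).
Variable M : (T -> R) -> R.
Hypothesis Nnorm : seminorm N.
Hypothesis ballC : forall f, dual_ball N f -> continuous (f \o e).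
Hypothesis Kcompact : compact K.
Hypothesis Kconvex : convex_along e K.
Hypothesis Mmean : mean_on K M.

Definition gap Phi u y := fsup Phi (e u - e y).

(** The supremum of [energy Phi u] over all [Phi] stands for the integral of
    [N (e u - e y) ^ 2] with respect to [M]. *)
Definition energy Phi u := M (fun y => gap Phi u y ^+ 2).

Lemma ball_gap_continuous f u : dual_ball N f ->
  continuous (fun y => f (e u - e y)).
Proof.
move=> fN; under eq_fun do rewrite (dual_ballB _ _ fN).
apply: continuous_subr; first exact: cst_continuous.
exact: ballC.
Qed.

Lemma gap_continuous Phi u : in_ball N Phi -> continuous (gap Phi u).
Proof.
move=> PN; apply: (fsup_continuous (h := fun y => e u - e y)) => f fP.
exact/ball_gap_continuous/PN.
Qed.

Lemma gap2_continuous Phi u : in_ball N Phi ->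
  continuous (fun y => gap Phi u y ^+ 2).
Proof. by move=> /(gap_continuous (u := u)) gc; apply: continuous_mulr. Qed.

Lemma energy_sub Phi Psi u : in_ball N Phi -> in_ball N Psi ->
  {subset Phi <= Psi} -> energy Phi u <= energy Psi u.
Proof.
move=> PN QN PQ; apply: (mean_le Mmean); try exact/within_continuousT/gap2_continuous.
by move=> y Ky; rewrite ler_pXn2r ?nnegrE ?fsup_ge0// fsup_sub.
Qed.

Lemma barycenter (us : seq T) : us != [::] -> {in us, forall u, K u} ->
  exists2 w, K w & (size us)%:R *: e w = \sum_(u <- us) e u.
Proof.
elim: us => // u us IH _ Kus.
have Ku : K u by apply: Kus; rewrite mem_head.
have [->|/IH] := eqVneq us [::].
  by exists u => //; rewrite big_seq1 scale1r.
case=> [v vus|w Kw wE]; first by apply: Kus; rewrite inE vus orbT.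
have n0 : 0 < (size us).+1%:R :> R by rewrite ltr0n.
have t01 : 0 <= ((size us).+1%:R^-1 : R) <= 1.
  by rewrite invr_ge0 ler0n invf_le1// ler1n.
have [w' Kw' w'E] := Kconvex Ku Kw t01; exists w' => //.
rewrite big_cons -wE /= w'E scalerDr !scalerA divff ?gt_eqF// scale1r.
by rewrite mulrBr mulr1 divff ?gt_eqF// -natr1 addrK.
Qed.

Variable c : R.
Hypothesis energy_le : forall Phi u, in_ball N Phi -> K u -> energy Phi u <= c.
Hypothesis energy_gt : forall u d, K u -> 0 < d ->
  exists2 Phi, in_ball N Phi & c - d < energy Phi u.

Section refinement.
Variables (d : R) (f0 : E -> R) (u0 : T).
Hypothesis d_gt0 : 0 < d.
Hypothesis f0_ball : dual_ball N f0.

Lemma barycenter_sum (us : seq T) (w y : T) :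
  (size us)%:R *: e w = \sum_(u <- us) e u ->
  (size us)%:R *: (e w - e y) = \sum_(u <- us) (e u - e y).
Proof.
move=> wE.
by rewrite scalerBr wE sumrB big_const_seq count_predT iter_addr_0 scaler_nat.
Qed.

(** The left side equals [sum a_u ^ 2 - 2 b sum a_u + n b ^ 2] with [b] the gap
    of the barycenter, and [n b <= sum a_u] by sublinearity. *)
Lemma deviation_le_variance (Phi : seq (E -> R)) (us : seq T) (w y : T) :
  in_ball N Phi -> (size us)%:R *: e w = \sum_(u <- us) e u ->
  \sum_(u <- us) (gap Phi u y - gap Phi w y) ^+ 2 <=
  \sum_(u <- us) gap Phi u y ^+ 2 - (size us)%:R * gap Phi w y ^+ 2.
Proof.
move=> PN /(@barycenter_sum _ _ y) wE; have [fD fZ] := fsup_sublinear PN.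
have nb : (size us)%:R * gap Phi w y <= \sum_(u <- us) gap Phi u y.
  rewrite /gap -fZ ?ler0n// wE; elim: (us) => [|u r IH].
    by rewrite !big_nil (sublinear0 (fsup_sublinear PN)).
  by rewrite !big_cons; apply: le_trans (fD _ _) _; rewrite lerD2l.
set b := gap Phi w y in nb *.
have -> : \sum_(u <- us) (gap Phi u y - b) ^+ 2 = \sum_(u <- us) gap Phi u y ^+ 2
    - 2 * b * \sum_(u <- us) gap Phi u y + (size us)%:R * b ^+ 2.
  elim: (us) => [|u r IH]; first by rewrite !big_nil /=; lra.
  by rewrite !big_cons IH /= -natr1; ring.
have b0 : 0 <= b by exact: fsup_ge0.
by have := ler_wpM2l b0 nb; rewrite expr2; lra.
Qed.

(** Small variance forces all gaps [a_u] to be within [eta] of the gap [b] of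
    the barycenter.  The functional [f] attaining [b] has the average of its
    values at the [e u - e y] equal to [b], while each value is at most [a_u];
    so no single value can be much smaller than [b], which exceeds about
    [2 * d]. *)
Lemma common_norming_functional
    (Phi : seq (E -> R)) (us : seq T) (w y : T) (eta : R) :
  in_ball N Phi -> f0 \in Phi -> u0 \in us ->
  (size us)%:R *: e w = \sum_(u <- us) e u ->
  2 * d < f0 (e u0 - e y) -> 0 < eta ->
  8 * (size us)%:R * eta <= d ->
  \sum_(u <- us) gap Phi u y ^+ 2 - (size us)%:R * gap Phi w y ^+ 2 <= eta ^+ 2 ->
  exists2 f, f \in Phi & {in us, forall u, 3 * d <= 2 * f (e u - e y)}.
Proof.
move=> PN f0P u0us wE f0y eta0 etad var.
set n : R := (size us)%:R in wE etad var *; set b := gap Phi w y in var *.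
pose a u := gap Phi u y.
have n1 : 1 <= n by rewrite /n ler1n; case: (us) u0us.
have scaleE := barycenter_sum y wE.
have b0 : 0 <= b by exact: fsup_ge0.
have dev u : u \in us -> `|a u - b| <= eta.
  move=> uus; rewrite -ler_sqr ?nnegrE ?normr_ge0 ?(ltW eta0)// real_normK ?num_real//.
  apply: (le_trans _ var); apply: le_trans (deviation_le_variance y PN wE).
  by rewrite (big_rem u)//= lerDl sumr_ge0// => v _; exact: sqr_ge0.
have a0 : 2 * d < a u0 by apply: lt_le_trans f0y _; exact: fsup_ge.
have eta_small : 8 * eta <= d.
  apply: le_trans etad; rewrite -mulrA ler_pM2l// ler_peMl// ltW//.
have bd : 2 * d - eta < b.
  by have := dev _ u0us; rewrite ler_norml; lra.
have [|f fP fb] := @fsup_attained _ _ Phi (e w - e y).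
  by rewrite -/(gap Phi w y) -/b; lra.
exists f => // u uus.
have fsum : n * b = \sum_(v <- us) f (e v - e y).
  rewrite /b /gap -fb -(dual_ballZ _ _ (PN _ fP)) scaleE.
  elim: (us) => [|v r IH].
    by rewrite !big_nil -[0 : E](scale0r 0) (dual_ballZ _ _ (PN _ fP)) mul0r.
  by rewrite !big_cons (dual_ballD _ _ (PN _ fP)) IH.
have defect : a u - f (e u - e y) <= \sum_(v <- us) (a v - f (e v - e y)).
  rewrite [leRHS](big_rem u)//= lerDl; apply: sumr_ge0 => v _.
  by rewrite subr_ge0; exact: fsup_ge.
have sum_cst (x : R) : \sum_(v <- us) x = n * x.
  by rewrite big_const_seq count_predT iter_addr_0 mulr_natl.
have : \sum_(v <- us) (a v - b) <= n * eta.
  rewrite -sum_cst big_seq [leRHS]big_seq; apply: ler_sum => v /dev.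
  by rewrite ler_norml => /andP[].
have := dev _ uus; move: defect; rewrite !sumrB sum_cst -fsum ler_norml.
move: etad; rewrite -mulrA; lra.
Qed.


(** Positive exactly where [f] exceeds [d] at every [e u - e y], [u] in [us], so
    that multiplying by it cuts down to this set within continuous functions. *)
Definition clip (f : E -> R) us y :=
  \prod_(u <- us) Num.max 0 (f (e u - e y) - d).

Lemma clip_ge0 f us y : 0 <= clip f us y.
Proof. by apply: prodr_ge0 => u _; rewrite le_max lexx. Qed.

Lemma clip_continuous f us : dual_ball N f -> continuous (clip f us).
Proof.
move=> fN; apply: continuous_prodr => u _; apply: continuous_maxr.
  exact: cst_continuous.
apply: continuous_subr; last exact: cst_continuous.
exact: ball_gap_continuous.
Qed.

(** The heart of the argument.  Choose [Phi] such that the barycenter [w] of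
    [us] has energy above [c - dl].  As all members of [us] have energy at most
    [c], the variance [V] has mean at most [n * dl], so where [g] lives it is
    mostly below [eta ^ 2], and there some [f] in [Phi] is at least [3 d / 2] at
    every [e u - e y].  Since [Phi] is finite, one [f] serves a set of positive
    mass. *)
Lemma clip_refinement (g : T -> R) (us : seq T) :
  continuous g -> (forall y, 0 <= g y) ->
  0 < M g -> (forall y, K y -> 0 < g y -> 2 * d < f0 (e u0 - e y)) ->
  {in us, forall u, K u} -> u0 \in us ->
  exists2 f, dual_ball N f & 0 < M (fun y => g y * clip f us y).
Proof.
move=> gc g0 Mg gf0 Kus u0us.
have usn0 : us != [::] by case: (us) u0us.
have [w Kw wE] := barycenter usn0 Kus.
have [G G0 gG] := within_continuous_bounded Kcompact (within_continuousT (K := K) gc).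
set n : R := (size us)%:R in wE.
have n0 : 0 < n by rewrite ltr0n lt0n size_eq0.
(* [8 n eta = d] is what [common_norming_functional] needs. *)
pose eta := d / (8 * n).
have eta0 : 0 < eta by rewrite divr_gt0// mulr_gt0.
(* With this [dl] the exceptional set [V > eta ^ 2] costs at most half of [M g]. *)
pose dl := eta ^+ 2 * M g / (2 * G * n).
have dl0 : 0 < dl.
  by rewrite divr_gt0//; [rewrite mulr_gt0// exprn_gt0|rewrite !mulr_gt0].
have [Phi1 P1N Phi1w] := energy_gt Kw dl0.
pose Phi := f0 :: Phi1.
have PN : in_ball N Phi by move=> f; rewrite inE => /predU1P[->|/P1N].
have Phiw : c - dl < energy Phi w.
  apply: lt_le_trans Phi1w _; apply: energy_sub => // f fP.
  by rewrite inE fP orbT.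
pose V y := - n * gap Phi w y ^+ 2 + \sum_(u <- us) gap Phi u y ^+ 2.
have V1K : {within K, continuous (fun y => \sum_(u <- us) gap Phi u y ^+ 2)}.
  by apply: within_continuous_sum => u _; exact/within_continuousT/gap2_continuous.
have V2K : {within K, continuous (fun y => gap Phi w y ^+ 2)}.
  exact/within_continuousT/gap2_continuous.
have VK : {within K, continuous V} by exact: within_continuous_lin.
have MV : M V <= n * dl.
  rewrite (mean_lin Mmean)// (mean_sum Mmean); last first.
    by move=> u _; exact/within_continuousT/gap2_continuous.
  have : \sum_(u <- us) energy Phi u <= n * c.
    have -> : n * c = \sum_(u <- us) c.
      by rewrite big_const_seq count_predT iter_addr_0 mulr_natl.
    by rewrite big_seq [leRHS]big_seq; apply: ler_sum => u /Kus; exact: energy_le.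
  have := ltW Phiw; rewrite -(ler_pM2l n0) -/(energy Phi w); lra.
pose k := (d / 2) ^+ size us.
have k0 : 0 < k by rewrite exprn_gt0// divr_gt0.
pose h (f : E -> R) y := g y * clip f us y.
have hK : {in Phi, forall f, {within K, continuous (h f)}}.
  move=> f /PN fN; apply/within_continuousT/continuous_mulr => //.
  exact: clip_continuous.
have SK := within_continuous_sum hK.
have pointwise y : K y ->
    k * g y <= k * G / eta ^+ 2 * V y + \sum_(f <- Phi) h f y.
  move=> Ky; have V0 : 0 <= V y.
    have := deviation_le_variance y PN wE.
    have : 0 <= \sum_(u <- us) (gap Phi u y - gap Phi w y) ^+ 2.
      by apply: sumr_ge0 => u _; exact: sqr_ge0.
    by rewrite /V -/n; lra.
  have S0 : 0 <= \sum_(f <- Phi) h f y.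
    by apply: sumr_ge0 => f _; rewrite mulr_ge0// clip_ge0.
  have kG : 0 < k * G / eta ^+ 2.
    by apply: divr_gt0; [exact: mulr_gt0|exact: exprn_gt0].
  have [gy0|gy0] := leP (g y) 0.
    have -> : g y = 0 by apply/le_anti; rewrite gy0 g0.
    by rewrite mulr0 addr_ge0// mulr_ge0// ltW.
  have [Veta|Veta] := leP (V y) (eta ^+ 2); last first.
    apply: (@le_trans _ _ (k * G)).
      by rewrite ler_pM2l//; apply: le_trans (ler_norm _) (gG _ Ky).
    have kG0 : 0 <= k * G by rewrite mulr_ge0// ltW.
    rewrite -[leLHS]addr0 lerD// -[leRHS]mulrA ler_peMr// mulrC.
    by rewrite ler_pdivlMr ?exprn_gt0// mul1r ltW.
  have eta_le : 8 * n * eta <= d.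
    by rewrite /eta mulrC divfK// gt_eqF// mulr_gt0.
  have var_le : \sum_(u <- us) gap Phi u y ^+ 2 - n * gap Phi w y ^+ 2 <= eta ^+ 2.
    by move: Veta; rewrite /V; lra.
  have [f fP ff] := common_norming_functional PN (mem_head _ _) u0us wE (gf0 _ Ky gy0)
    eta0 eta_le var_le.
  apply: (@le_trans _ _ (h f y)); last first.
    rewrite (big_rem f)//= addrCA lerDl addr_ge0//.
      by rewrite mulr_ge0// ltW.
    by apply: sumr_ge0 => f' _; rewrite mulr_ge0// clip_ge0.
  rewrite mulrC ler_pM2l// /k /clip; elim: (us) ff => [|u r IH] ff.
    by rewrite big_nil.
  rewrite big_cons /= exprS; apply: ler_pM.
  - by rewrite divr_ge0// ltW.
  - by rewrite exprn_ge0// divr_ge0// ltW.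
  - by rewrite le_max; apply/orP; right; have := ff _ (mem_head _ _); lra.
  - by apply: IH => v vr; apply: ff; rewrite inE vr orbT.
have [f fP hf] : exists2 f, f \in Phi & 0 < M (h f); last first.
  by exists f => //; exact: PN.
apply: (mean_sum_gt0 Mmean) => //.
have : M (fun y => k * g y) <=
    M (fun y => k * G / eta ^+ 2 * V y + \sum_(f <- Phi) h f y).
  apply: (mean_le Mmean) => //; last exact: within_continuous_lin.
  by apply/within_continuousT/continuous_mulr => //; exact: cst_continuous.
rewrite (meanZ Mmean _ (within_continuousT gc)) (mean_lin Mmean _ VK SK).
have : k * G / eta ^+ 2 * M V <= k * M g / 2.
  apply: (@le_trans _ _ (k * G / eta ^+ 2 * (n * dl))).
    rewrite ler_pM2l//.
    by apply: divr_gt0; [exact: mulr_gt0|exact: exprn_gt0].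
  rewrite le_eqVlt; apply/orP; left; apply/eqP; rewrite /dl; field.
  by rewrite !gt_eqF.
have : 0 < k * M g by rewrite mulr_gt0.
lra.
Qed.

End refinement.

(** A state consists of a function [g] of positive mean and the points chosen
    so far.  A step refines [g] by a functional [f] that is larger by [d] at the
    old points than where the new [g] is positive, and then picks as new
    point one that nearly maximizes [f] where the new [g] is positive.  The
    resulting sequences are the forbidden ones of [no_separated_sequence]. *)
Lemma no_far_functional (d : R) (f0 : E -> R) (u0 : T) :
  0 < d -> dual_ball N f0 -> K u0 ->
  0 < M (fun y => Num.max 0 (f0 (e u0 - e y) - 2 * d)) -> False.
Proof.
move=> d0 f0N Ku0 Mf0.
pose valid (p : (T -> R) * seq T) := [/\ continuous p.1, forall y, 0 <= p.1 y,
  0 < M p.1, forall y, K y -> 0 < p.1 y -> 2 * d < f0 (e u0 - e y) &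
  {in p.2, forall u, K u} /\ u0 \in p.2].
pose next (p : (T -> R) * seq T) (q : (E -> R) * T) :=
  ((fun z => p.1 z * clip d q.1 p.2 z), q.2 :: p.2).
have next_gt0 p q z : (forall y, 0 <= p.1 y) -> 0 < (next p q).1 z ->
    0 < p.1 z /\ {in p.2, forall u, d < q.1 (e u - e z)}.
  move=> p0 /= pz; have [p1z|p1z] := ltP 0 (p.1 z); last first.
    move: pz; have -> : p.1 z = 0 by apply/le_anti; rewrite p1z p0.
    by rewrite mul0r ltxx.
  split=> // u up; rewrite ltNge; apply/negP => qd; move: pz.
  rewrite /clip (big_rem u)//= max_l; last by lra.
  by rewrite mul0r mulr0 ltxx.
have step p : exists q, valid p -> [/\ dual_ball N q.1, K q.2,
    0 < (next p q).1 q.2,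
    forall z, K z -> 0 < (next p q).1 z -> q.1 (e z) <= q.1 (e q.2) + d / 2 &
    valid (next p q)].
  have [vp|nv] := pselect (valid p); last by exists (fun=> 0, u0).
  have [pc p0 Mp pf0 [Kp u0p]] := vp.
  have [f fN Mf] := clip_refinement d0 f0N pc p0 Mp pf0 Kp u0p.
  have gc : continuous (fun y => p.1 y * clip d f p.2 y).
    by apply: continuous_mulr => //; exact: clip_continuous.
  pose A := [set f (e z) | z in [set z | K z /\ 0 < p.1 z * clip d f p.2 z]].
  have A0 : A !=set0.
    have [x Kx gx] := mean_gt0_ex Mmean (within_continuousT gc) Mf.
    by exists (f (e x)), x.
  have [C C0 fC] := dual_ball_bounded ballC Kcompact fN.
  have Aub : has_ubound A.
    exists C => _ [z [Kz _] <-]; exact: le_trans (ler_norm _) (fC _ Kz).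
  have d2 : 0 < d / 2 by lra.
  (* A near-maximizer [y] of [f] gives the upper bound [f (e y) + d / 2]. *)
  have [_ [y [Ky gy] <-] yA] := sup_adherent d2 (conj A0 Aub).
  exists (f, y) => _; split => //=.
    move=> z Kz gz; have : f (e z) <= sup A by apply: ub_le_sup => //; exists z.
    lra.
  split => //=.
  - by move=> z; rewrite mulr_ge0// clip_ge0.
  - by move=> z Kz /(next_gt0 p (f, y) z p0) [/(pf0 _ Kz)].
  - split; last by rewrite inE u0p orbT.
    by move=> u; rewrite inE => /predU1P[->|/Kp].
have [F FP] := choice step.
pose st := fix st n := if n is n'.+1 then next (st n') (F (st n'))
  else ((fun y => Num.max 0 (f0 (e u0 - e y) - 2 * d)), [:: u0]).
have st_valid n : valid (st n).
  elim: n => [|n IH]; last by have [] := FP _ IH.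
  split => //=.
  - apply: continuous_maxr; first exact: cst_continuous.
    apply: continuous_subr; last exact: cst_continuous.
    exact: ball_gap_continuous.
  - by move=> y; rewrite le_max lexx.
  - by move=> y Ky; rewrite lt_max ltxx/=; lra.
  - by split; [move=> u; rewrite inE => /eqP ->|rewrite mem_head].
pose f n := (F (st n)).1; pose y n := (F (st n)).2.
have stP n := FP _ (st_valid n).
have st_mono n m z : (n <= m)%N -> 0 < (st m).1 z -> 0 < (st n).1 z.
  move=> /subnK <-; elim: (m - n)%N => //= k IH.
  by move=> /next_gt0[|/IH//]; have [] := st_valid (k + n)%N.
have y_gt0 n : 0 < (st n.+1).1 (y n) by have [] := stP n.
have y_mem i n : (i < n)%N -> y i \in (st n).2.
  elim: n => // n IH; rewrite ltnS leq_eqVlt => /predU1P[->|/IH yi].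
    by rewrite /= mem_head.
  by rewrite /= inE yi orbT.
apply: (@no_separated_sequence _ _ N T e K Nnorm ballC Kcompact y f d d0).
- by move=> n; have [] := stP n.
- by move=> n; have [] := stP n.
- move=> i n ni; have [fN _ _ _ _] := stP n.
  have [_ p0 _ _ _] := st_valid n.
  have [_ /(_ _ (y_mem _ _ ni))] := next_gt0 _ _ _ p0 (y_gt0 n).
  by rewrite (dual_ballB _ _ fN) -/(f n) -/(y n); lra.
- move=> n m nm; have [_ _ _ fle _] := stP n; apply: fle.
    by have [] := stP m.
  exact: (st_mono n.+1 m.+1).
Qed.

(** If [c = 0], then [y] is at distance zero from both [u] and [v] in mean.  If
    [c > 0], then some functional exceeds [2 * d] at [e u - e y] for a set of
    [y] of positive mass, and [no_far_functional] applies. *)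
Lemma constant_energy_singleton : (forall x, N x = 0 -> x = 0) ->
  forall u v, K u -> K v -> e u = e v.
Proof.
move=> N0 u v Ku Kv.
have c0 : 0 <= c.
  apply: le_trans (energy_le (Phi := [::]) _ Ku) => //.
  apply: (mean_ge0 Mmean) => [|y _]; last exact: sqr_ge0.
  exact/within_continuousT/gap2_continuous.
have [c1|c1] := ltP 0 c; last first.
  have {c0 c1}c0 : c = 0 by apply/le_anti; rewrite c0 c1.
  apply/eqP; rewrite -subr_eq0; apply/eqP/N0.
  have [f fN <-] := norming (e u - e v) Nnorm.
  pose Phi := [:: f; fun x => - f x].
  have PN : in_ball N Phi.
    move=> g; rewrite !inE => /orP[/eqP ->//|/eqP ->]; split=> [a x y|x].
      by rewrite fN.1; ring.
    by rewrite -(dual_ballN _ fN) -(seminormN Nnorm); exact: fN.2.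
  have gapP w y : f (e w - e y) ^+ 2 <= gap Phi w y ^+ 2.
    rewrite -real_normK ?num_real// ler_pXn2r ?nnegrE ?fsup_ge0//.
    have := fsup_ge (e w - e y) (mem_head f [:: fun x => - f x]).
    have := @fsup_ge _ _ Phi (fun x => - f x) (e w - e y).
    rewrite !inE eqxx orbT => /(_ isT) ? ?.
    by rewrite ler_norml; apply/andP; split=> //; rewrite lerNl.
  have gapK w : {within K, continuous (fun y => gap Phi w y ^+ 2)}.
    exact/within_continuousT/gap2_continuous.
  have : M (fun=> f (e u - e v) ^+ 2) <=
      M (fun y => 2 * (gap Phi u y ^+ 2) + (2 * (gap Phi v y ^+ 2) + 0)).
    apply: (mean_le Mmean); first exact: within_continuous_cst.
      by do 2!apply: within_continuous_lin => //; exact: within_continuous_cst.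
    move=> y Ky; have := gapP u y; have := gapP v y.
    rewrite !(dual_ballB _ _ fN); have := sqr_ge0 (f (e u) + f (e v) - 2 * f (e y)).
    rewrite !expr2; lra.
  rewrite (mean_cst Mmean) (mean_lin Mmean) ?(mean_lin Mmean) ?(mean0 Mmean)//.
  - have := energy_le PN Ku; have := energy_le PN Kv; rewrite /energy c0 => ? ? H.
    by apply/eqP; rewrite -sqrf_eq0; apply/eqP/le_anti; rewrite sqr_ge0 andbT; lra.
  - exact: within_continuous_cst.
  - by apply: within_continuous_lin => //; exact: within_continuous_cst.
exfalso.
have [B Bb] := weakly_compact_bounded Nnorm ballC Kcompact Kconvex.
(* [d <= 1 / 4] and [4 d <= c] yield [(2 d) ^ 2 < c]. *)
pose d := Num.min c 1 / 4.
have d0 : 0 < d by rewrite divr_gt0// lt_min c1 ltr01.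
have dc : 4 * d ^+ 2 < c.
  have : d * (4 * d) <= d.
    by apply: ler_piMr (ltW d0) _; rewrite /d mulrC divfK// ge_min lexx orbT.
  have : 4 * d <= c by rewrite /d mulrC divfK// ge_min lexx.
  rewrite expr2; lra.
have cd : 0 < c - 4 * d ^+ 2 by lra.
have [Phi PN Phiu] := energy_gt Ku cd.
pose h (f : E -> R) y := Num.max 0 (f (e u - e y) - 2 * d).
have hK : {in Phi, forall f, {within K, continuous (h f)}}.
  move=> f /PN fN; apply/within_continuousT/continuous_maxr; first exact: cst_continuous.
  apply: continuous_subr; last exact: cst_continuous.
  exact: ball_gap_continuous.
have [f fP hf] : exists2 f, f \in Phi & 0 < M (h f); last first.
  exact: no_far_functional d0 (PN _ fP) Ku hf.
apply: (mean_sum_gt0 Mmean) => //.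
have B0 : 0 <= B by apply: le_trans (seminorm_ge0 Nnorm _) (Bb _ Ku).
pose C := 2 * B + 2 * d.
have C0 : 0 < C by rewrite /C; lra.
have SK := within_continuous_sum hK.
have : M (fun y => gap Phi u y ^+ 2) <=
    M (fun y => C * (\sum_(f <- Phi) h f y) + 4 * d ^+ 2).
  apply: (mean_le Mmean); first exact/within_continuousT/gap2_continuous.
    by apply: within_continuous_lin => //; exact: within_continuous_cst.
  move=> y Ky; have h0 f : 0 <= h f y by rewrite le_max lexx.
  have S0 : 0 <= \sum_(f <- Phi) h f y by apply: sumr_ge0.
  have [s2d|s2d] := leP (gap Phi u y) (2 * d).
    have : gap Phi u y ^+ 2 <= (2 * d) ^+ 2.
      by rewrite ler_pXn2r ?nnegrE ?fsup_ge0// mulr_ge0// ltW.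
    have : 0 <= C * (\sum_(f <- Phi) h f y) by rewrite mulr_ge0// ltW.
    rewrite exprMn !expr2; lra.
  have [|f fP fs] := @fsup_attained _ _ Phi (e u - e y).
    by apply: lt_trans s2d; rewrite mulr_gt0.
  have fle : h f y <= \sum_(f <- Phi) h f y.
    by rewrite (big_rem f)//= lerDl sumr_ge0.
  have sle : gap Phi u y <= 2 * B.
    apply: le_trans (fsup_le_norm Nnorm _ PN) _.
    apply: le_trans (Nnorm.1 _ _) _; rewrite seminormN//.
    by have := Bb _ Ku; have := Bb _ Ky; lra.
  have hs : gap Phi u y - 2 * d <= h f y by rewrite /h le_max fs lexx orbT.
  have : (gap Phi u y - 2 * d) * (gap Phi u y + 2 * d) <=
      (\sum_(f <- Phi) h f y) * C.
    by apply: ler_pM; rewrite /C; lra.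
  rewrite !expr2; lra.
rewrite (mean_lin Mmean _ SK (@within_continuous_cst _ _ _ _)) (mean_cst Mmean) => H.
by rewrite -(pmulr_rgt0 _ C0); move: Phiu; rewrite /energy; lra.
Qed.

End constant_energy.

(** * Minimal invariant sets *)

Section abstract_fixed_point.
Variables (R : realType) (S : semitopologicalSemigroupType).
Variables (E : lmodType R) (N : E -> R) (T : topologicalType) (e : T -> E).
Variables (K : set T) (act : S -> T -> T).
Hypothesis Nnorm : seminorm N.
Hypothesis N0 : forall x, N x = 0 -> x = 0.
Hypothesis ballC : forall f, dual_ball N f -> continuous (f \o e).
Hypothesis Kcompact : compact K.
Hypothesis Kconvex : convex_along e K.
Hypothesis actK : forall s x, K x -> K (act s x).
Hypothesis actA : forall s t x, K x -> act s (act t x) = act (s * t)%g x.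
Hypothesis actC : {within [set: S] `*` K, continuous (fun p => act p.1 p.2)}.
Hypothesis actN : forall s x y, K x -> K y ->
  N (e (act s x) - e (act s y)) <= N (e x - e y).

(** Closedness and convexity are stated relative to [K], which makes both stable
    under intersections. *)
Definition admissible (A : set T) :=
  [/\ A `<=` K, A !=set0, K `&` closure A `<=` A,
    forall u v w t, A u -> A v -> K w -> 0 <= t <= 1 ->
      e w = t *: e u + (1 - t) *: e v -> A w &
    forall s x, A x -> A (act s x)].

Lemma admissible_chain (F : set (set T)) : F !=set0 -> F `<=` admissible ->
  total_on F subset -> admissible (\bigcap_(A in F) A).
Proof.
move=> [A0 FA0] Fadm Ftot; have [A0K _ _ _ _] := Fadm _ FA0.
split.
- by move=> x /(_ _ FA0) /A0K.
- have FF : ProperFilter (filter_from F id).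
    apply: filter_from_proper; last by move=> A /Fadm[].
    apply: filter_from_filter; first by exists A0.
    move=> A B FA FB; have [AB|BA] := Ftot _ _ FA FB.
      by exists A => // x Ax; split => //; exact: AB.
    by exists B => // x Bx; split => //; exact: BA.
  have [|x [Kx Fx]] := Kcompact FF; first by exists A0.
  exists x => A FA; have [_ _ Aclosed _ _] := Fadm _ FA; apply: Aclosed.
  by split => //; move: Fx; rewrite clusterE; apply; exists A.
- move=> x [Kx clx] A FA; have [_ _ Aclosed _ _] := Fadm _ FA; apply: Aclosed.
  by split => //; apply: closure_subset clx => y; apply.
- move=> u v w t Fu Fv Kw t01 wE A FA; have [_ _ _ Aconv _] := Fadm _ FA.
  by apply: (Aconv u v w t) => //; [exact: Fu|exact: Fv].
- by move=> s x Fx A FA; have [_ _ _ _ Ainv] := Fadm _ FA; apply: Ainv; exact: Fx.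
Qed.

Lemma exists_minimal_admissible : K !=set0 ->
  exists2 A, admissible A & forall B, admissible B -> B `<=` A -> B = A.
Proof.
move=> K0; have Kadm : admissible K by split => // x [].
pose X := {A | admissible A}.
pose rX (A B : X) := `[< sval B `<=` sval A >].
have [| | | |[A Aadm] Amin] := @Zorn X rX.
- by move=> A; exact/asboolP.
- by move=> A B C /asboolP AB /asboolP BC; apply/asboolP; exact: subset_trans AB.
- move=> [A Aadm] [B Badm] /asboolP /= AB /asboolP /= BA.
  by apply: eq_exist; exact/seteqP.
- move=> C Ctot; have [[A0 CA0]|C0] := pselect (C !=set0); last first.
    by exists (exist _ K Kadm) => A CA; case: C0; exists A.
  have Dadm : admissible (\bigcap_(A in [set sval A | A in C]) A).
    apply: admissible_chain.
    - by exists (sval A0), A0.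
    - by move=> _ [A _ <-]; exact: svalP.
    - move=> _ _ [A CA <-] [B CB <-].
      by have [/asboolP|/asboolP] := Ctot _ _ CA CB; [right|left].
  exists (exist _ _ Dadm) => A CA; apply/asboolP => x /=.
  by apply; exists A.
- exists A => // B Badm BA.
  have : rX (exist _ A Aadm) (exist _ B Badm) by exact/asboolP.
  by move=> /Amin [].
Qed.

Section minimal.
Variable A : set T.
Hypothesis Aadm : admissible A.

Let AK : A `<=` K. Proof. by case: Aadm. Qed.

Lemma admissible_compact : compact A.
Proof.
have [_ _ Aclosed _ _] := Aadm.
have -> : A = K `&` closure A.
  apply/seteqP; split => // x Ax; split; [exact: AK|exact: subset_closure].
by apply: compact_closedI => //; exact: closed_closure.
Qed.

Lemma admissible_convex : convex_along e A.
Proof.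
have [_ _ _ Aconv _] := Aadm.
move=> u v t Au Av t01; have [w Kw wE] := Kconvex (AK Au) (AK Av) t01.
by exists w => //; exact: Aconv wE.
Qed.

Variable M : (T -> R) -> R.
Hypothesis Mmean : mean_on A M.
Hypothesis Minv : forall s f, {within A, continuous f} -> M (f \o act s) = M f.

(** Every [y] has a functional that attains the norm at [e u - e y], and the
    corresponding inequality persists near [y]; compactness leaves finitely many
    functionals. *)
Lemma dini (h : T -> R) u (d : R) : {within A, continuous h} -> 0 < d ->
  (forall y, A y -> h y <= N (e u - e y) ^+ 2) ->
  exists2 Phi, in_ball N Phi & forall y, A y -> h y <= gap e Phi u y ^+ 2 + d.
Proof.
move=> hc d0 hN.
pose up (Phi : seq (E -> R)) := [set Psi | in_ball N Psi /\ {subset Phi <= Psi}].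
have FF : Filter (filter_from (in_ball N) up).
  apply: filter_from_filter; first by exists [::].
  move=> Phi Psi PN QN; exists (Phi ++ Psi).
    by move=> f; rewrite mem_cat => /orP[/PN|/QN].
  move=> Q [QB PQ]; split; split => // f fP; apply: PQ.
    by rewrite mem_cat fP.
  by rewrite mem_cat fP orbT.
have cA : near_covering_within A.
  exact/near_covering_withinP/compact_near_coveringP/admissible_compact.
have [|Phi PN up_le] :=
    cA _ _ (fun Phi y => h y <= gap e Phi u y ^+ 2 + d) FF; last first.
  by exists Phi => //; apply: (up_le Phi); split.
move=> x Ax.
have [f fN fx] := norming (e u - e x) Nnorm.
have fB : in_ball N [:: f] by move=> g; rewrite inE => /eqP ->.
have kc : {within A, continuous (fun y => - 1 * gap e [:: f] u y ^+ 2 + h y)}.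
  apply: within_continuous_lin => //; apply: within_continuousT.
  exact: (gap2_continuous ballC).
have kx : - 1 * gap e [:: f] u x ^+ 2 + h x < d.
  have : N (e u - e x) ^+ 2 <= gap e [:: f] u x ^+ 2.
    rewrite ler_pXn2r ?nnegrE ?fsup_ge0 ?seminorm_ge0// -fx.
    by apply: fsup_ge; rewrite mem_head.
  by have := hN _ Ax; lra.
move/subspace_continuousP : kc => /(_ x Ax _ (lt_nbhsl kx)).
rewrite /within /= => kx'.
exists ([set y | A y -> - 1 * gap e [:: f] u y ^+ 2 + h y < d], up [:: f]).
  by split => //=; exists [:: f].
move=> [y Psi] /= [/= yd [PN fP]] Ay; have := yd Ay.
have : gap e [:: f] u y ^+ 2 <= gap e Psi u y ^+ 2.
  by rewrite ler_pXn2r ?nnegrE ?fsup_ge0// fsup_sub.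
lra.
Qed.

Definition sublevel c := [set u | A u /\
  forall Phi, in_ball N Phi -> energy e M Phi u <= c].

(** The integrand of the energy of [act s u], transported by [act s], is at most
    [N (e u - e y) ^ 2] because the action is nonexpansive; [dini] then bounds
    its mean by the energy of [u]. *)
Lemma sublevel_act c s u : sublevel c u -> sublevel c (act s u).
Proof.
have [_ _ _ _ Ainv] := Aadm.
move=> [Au uc]; split; first exact: Ainv.
move=> Phi PN; pose h y := gap e Phi (act s u) y ^+ 2.
have hA : {within A, continuous h} by exact/within_continuousT/(gap2_continuous ballC).
have hsA : {within A, continuous (h \o act s)}.
  apply: comp_act_within => //.
  by apply: continuous_subspaceW actC => -[t x] [_ /= /AK].
rewrite /energy -(Minv s hA); apply/ler_addgt0Pr => d d0.
have [|Psi QN hPsi] := @dini (h \o act s) u d hsA d0.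
  move=> y Ay; rewrite /h /= ler_pXn2r ?nnegrE ?fsup_ge0 ?seminorm_ge0//.
  apply: le_trans (fsup_le_norm Nnorm _ PN) _; apply: actN; exact: AK.
have gA : {within A, continuous (fun y => gap e Psi u y ^+ 2)}.
  exact/within_continuousT/(gap2_continuous ballC).
apply: le_trans (_ : M (fun y => 1 * gap e Psi u y ^+ 2 + d) <= _).
  apply: (mean_le Mmean) => //.
    by apply: within_continuous_lin => //; exact: within_continuous_cst.
  by move=> y Ay; rewrite mul1r; exact: hPsi.
rewrite (mean_lin Mmean _ gA (@within_continuous_cst _ _ _ _))
  (mean_cst Mmean) mul1r lerD2r.
exact: uc.
Qed.

Lemma sublevel_convex c u v w t : sublevel c u -> sublevel c v -> K w ->
  0 <= t <= 1 -> e w = t *: e u + (1 - t) *: e v -> sublevel c w.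
Proof.
have [_ _ _ Aconv _] := Aadm.
move=> [Au uc] [Av vc] Kw t01 wE; split; first exact: Aconv wE.
move=> Phi PN; have [fD fZ] := fsup_sublinear PN; have /andP[t0 t1] := t01.
have gA x : {within A, continuous (fun y => gap e Phi x y ^+ 2)}.
  exact/within_continuousT/(gap2_continuous ballC).
apply: le_trans (_ : M (fun y => t * gap e Phi u y ^+ 2 +
    ((1 - t) * gap e Phi v y ^+ 2 + 0)) <= _).
  apply: (mean_le Mmean) => //.
    by do 2!apply: within_continuous_lin => //; exact: within_continuous_cst.
  move=> y Ay; rewrite addr0.
  have : gap e Phi w y <= t * gap e Phi u y + (1 - t) * gap e Phi v y.
    rewrite /gap -!fZ//; last by lra.
    have -> : e w - e y = t *: (e u - e y) + (1 - t) *: (e v - e y).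
      rewrite wE !scalerBr addrACA -opprD -scalerDl [t + _]addrC subrK.
      by rewrite scale1r.
    exact: fD.
  set a := gap e Phi u y; set b := gap e Phi v y => gab.
  have : gap e Phi w y ^+ 2 <= (t * a + (1 - t) * b) ^+ 2.
    rewrite ler_pXn2r ?nnegrE ?fsup_ge0//.
    by rewrite addr_ge0// mulr_ge0 ?fsup_ge0//; lra.
  have : 0 <= t * (1 - t) * (a - b) ^+ 2.
    by rewrite mulr_ge0 ?sqr_ge0// mulr_ge0//; lra.
  rewrite !expr2; lra.
rewrite (mean_lin Mmean) ?(mean_lin Mmean)//; last first.
- by apply: within_continuous_lin => //; exact: within_continuous_cst.
- exact: within_continuous_cst.
rewrite (mean0 Mmean) addr0.
have := ler_wpM2l t0 (uc _ PN); have t1' : 0 <= 1 - t by lra.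
have := ler_wpM2l t1' (vc _ PN); rewrite /energy; lra.
Qed.

Lemma sublevel_closed c : K `&` closure (sublevel c) `<=` sublevel c.
Proof.
have [_ _ Aclosed _ _] := Aadm.
move=> x [Kx clx]; have Ax : A x.
  by apply: Aclosed; split => //; apply: closure_subset clx => y [].
split=> // Phi PN; apply/ler_addgt0Pr => d d0.
have [B Bb] := weakly_compact_bounded Nnorm ballC Kcompact Kconvex.
have B0 : 0 <= B by apply: le_trans (seminorm_ge0 Nnorm _) (Bb _ Kx).
have [fD fZ] := fsup_sublinear PN.
(* Gaps [a] are at most [2 * B], so [(a + eta) ^ 2 <= a ^ 2 + d]. *)
pose eta := Num.min 1 (d / (4 * B + 1)).
have B41 : 0 < 4 * B + 1 by lra.
have eta0 : 0 < eta by rewrite lt_min ltr01 divr_gt0.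
have eta1 : eta <= 1 by rewrite ge_min lexx.
have etad : eta * (4 * B + 1) <= d by rewrite -ler_pdivlMr// ge_min lexx orbT.
have gx : gap e Phi x x < eta.
  by rewrite /gap subrr (sublinear0 (fsup_sublinear PN)).
have [v [[Av vc] /= vx]] : sublevel c `&` [set v | gap e Phi x v < eta] !=set0.
  by apply: clx; exact: (gap_continuous (u := x) ballC PN (lt_nbhsl gx)).
have gA z : {within A, continuous (fun y => gap e Phi z y ^+ 2)}.
  exact/within_continuousT/(gap2_continuous ballC).
apply: le_trans (_ : M (fun y => 1 * gap e Phi v y ^+ 2 + d) <= _).
  apply: (mean_le Mmean) => //.
    by apply: within_continuous_lin => //; exact: within_continuous_cst.
  move=> y Ay; rewrite mul1r.
  have : gap e Phi x y <= gap e Phi v y + gap e Phi x v.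
    by rewrite /gap; have := fD (e v - e y) (e x - e v); rewrite addrC addrA subrK.
  have vB : gap e Phi v y <= 2 * B.
    apply: le_trans (fsup_le_norm Nnorm _ PN) _.
    apply: le_trans (Nnorm.1 _ _) _; rewrite seminormN//.
    by have := Bb _ (AK Av); have := Bb _ (AK Ay); lra.
  have v0 : 0 <= gap e Phi v y by exact: fsup_ge0.
  have x0 : 0 <= gap e Phi x y by exact: fsup_ge0.
  move=> xv; have : gap e Phi x y ^+ 2 <= (gap e Phi v y + eta) ^+ 2.
    by rewrite ler_pXn2r ?nnegrE//; lra.
  have : eta * gap e Phi v y <= eta * (2 * B) by rewrite ler_pM2l.
  have : eta * eta <= eta * 1 by rewrite ler_pM2l.
  rewrite !expr2; lra.
rewrite (mean_lin Mmean _ (gA v) (@within_continuous_cst _ _ _ _))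
  (mean_cst Mmean) mul1r lerD2r.
exact: vc.
Qed.

Hypothesis Amin : forall B, admissible B -> B `<=` A -> B = A.

Lemma sublevel_minimal c : sublevel c !=set0 -> sublevel c = A.
Proof.
move=> c0; apply: Amin; last by move=> x [].
split => //.
- by move=> x [/AK].
- exact: sublevel_closed.
- by move=> u v w t; exact: sublevel_convex.
- by move=> s x; exact: sublevel_act.
Qed.

(** The constant value of the energy is the infimum of the levels with a
    nonempty sublevel set; there are such levels because [K] is bounded. *)
Lemma minimal_singleton u v : A u -> A v -> e u = e v.
Proof.
move=> Au Av.
have [B Bb] := weakly_compact_bounded Nnorm ballC Kcompact Kconvex.
pose L := [set c | sublevel c !=set0].
have B0 : 0 <= B by apply: le_trans (seminorm_ge0 Nnorm _) (Bb _ (AK Au)).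
have gA Phi x : in_ball N Phi -> {within A, continuous (fun y => gap e Phi x y ^+ 2)}.
  by move=> PN; exact/within_continuousT/(gap2_continuous ballC).
have LB : L ((2 * B) ^+ 2).
  exists u; split => // Phi PN; rewrite -[leRHS](mean_cst Mmean).
  apply: (mean_le Mmean); [exact: gA|exact: within_continuous_cst|move=> y Ay].
  rewrite ler_pXn2r ?nnegrE ?fsup_ge0// ?mulr_ge0//.
  apply: le_trans (fsup_le_norm Nnorm _ PN) _.
  apply: le_trans (Nnorm.1 _ _) _; rewrite seminormN//.
  by have := Bb _ (AK Au); have := Bb _ (AK Ay); lra.
have Llb : lbound L 0.
  move=> c [x [Ax xc]]; have N0' : in_ball N [::] by [].
  apply: le_trans (xc _ N0'); apply: (mean_ge0 Mmean); first exact: gA.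
  by move=> y _; exact: sqr_ge0.
have Linf : has_inf L by split; [exists ((2 * B) ^+ 2)|exists 0].
apply: (@constant_energy_singleton _ _ N _ e A M Nnorm ballC
  admissible_compact admissible_convex Mmean (inf L)) => //.
- move=> Phi x PN Ax; apply/ler_addgt0Pr => d d0.
  have [c Lc cd] := inf_adherent d0 Linf.
  move: Ax; rewrite -(sublevel_minimal Lc) => -[_ /(_ _ PN) xc].
  exact: le_trans xc (ltW cd).
- move=> x d Ax d0; apply: contrapT => nP.
  have : L (inf L - d).
    exists x; split => // Phi PN; rewrite leNgt; apply/negP => xP.
    by apply: nP; exists Phi.
  by move=> /(ge_inf Linf.2); lra.
Qed.

End minimal.

Proposition abstract_common_fixed_point :
  (exists m, left_invariant_mean (LUC R S) m) -> K !=set0 ->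
  exists2 x, K x & forall s, e (act s x) = e x.
Proof.
move=> lim /exists_minimal_admissible [A Aadm Amin].
have [AK A0 _ _ Ainv] := Aadm; have [x Ax] := A0.
have [||||M Mmean Minv] := @orbit_mean R S T A act _ _ _ _ lim A0.
- exact: admissible_compact.
- by [].
- by move=> s t y /AK; exact: actA.
- by apply: continuous_subspaceW actC => -[t y] [_ /= /AK].
exists x; first exact: AK.
move=> s; apply: (minimal_singleton Aadm Mmean Minv Amin) => //.
exact: Ainv.
Qed.

End abstract_fixed_point.

(** * Real and complex Banach spaces *)

Section weak_continuity.
Variables (F : numFieldType) (E : normedModType F).

(** Bounded linear functionals belong to the continuous dual, whose initial
    topologies generate the weak one. *)
Lemma bounded_linear_weakly_continuous (f : E -> F^o) (C : F) : linear f ->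
  0 < C -> (forall x, `|f x| <= C * `|x|) -> continuous (f : weak E -> F^o).
Proof.
move=> flin C0 fC.
pose flinM := GRing.isLinear.Build F E F^o *:%R f flin.
pose fL : {linear E -> F^o} := HB.pack f flinM.
have fc : continuous (fL : E -> F^o).
  move=> x; apply/cvgrPdist_lt => eps eps0.
  have : \forall y \near x, `|x - y| < eps / C.
    by apply: cvgr_dist_lt; rewrite // divr_gt0.
  apply: filterS => y xy; rewrite -linearB; apply: le_lt_trans (fC _) _.
  by rewrite mulrC -ltr_pdivlMr.
pose phi : continuous_dual E := exist _ fL fc.
move=> x.
have /cvg_sup /(_ phi) xphi : nbhs (x : weak E) --> (x : weak E) by [].
move=> A /(@initial_continuous E F^o f x) Af.
exact: xphi.
Qed.

Lemma convex_set_segment (K : set E) u v (t : F) :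
  convex_set (K : set (convex_lmodType E)) -> K u -> K v -> 0 <= t <= 1 ->
  K (t *: u + (1 - t) *: v).
Proof.
move=> Kc Ku Kv /andP[t0 t1].
have /(_ (Itv01 t0 t1)) := Kc u v _ (mem_set Ku) (mem_set Kv).
by rewrite inE.
Qed.

End weak_continuity.

Proposition real_fixed_point_property (R : realType)
    (S : semitopologicalSemigroupType) :
  (exists m : (S -> R[i]^o) -> R[i], left_invariant_mean (LUC R S) m) ->
  fixed_point_property S R.
Proof.
move=> lim E K act K0 Kc Kconv [actK actA] actC actN.
have := @abstract_common_fixed_point R S E (fun x => `|x|) (weak E) id K act.
apply => //.
- by split=> [x y|a x]; [exact: ler_normD|exact: normrZ].
- by move=> x /normr0_eq0.
- move=> f fN.
  apply: (@bounded_linear_weakly_continuous R E f 1); rewrite ?ltr01//.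
    by move=> a x y; exact: fN.1.
  move=> x; rewrite mul1r ler_norml fN.2 andbT.
  by have := dual_ball_ge x fN; rewrite normrN.
- move=> u v t Ku Kv t01; exists (t *: u + (1 - t) *: v) => //.
  exact: convex_set_segment.
Qed.

(** An alias, because [E] itself keeps its complex scalars. *)
Definition realified (R : rcfType) (E : lmodType R[i]) : Type := E.

Section realified.
Variables (R : rcfType) (E : lmodType R[i]).

HB.instance Definition _ := GRing.Zmodule.on (realified E).

Definition realified_scale (a : R) (x : realified E) : realified E :=
  a%:C *: (x : E).

Fact realified_scaleA a b x :
  realified_scale a (realified_scale b x) = realified_scale (a * b) x.
Proof. by rewrite /realified_scale scalerA rmorphM. Qed.

Fact realified_scale1 : left_id 1 realified_scale.
Proof. by move=> x; rewrite /realified_scale scale1r. Qed.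

Fact realified_scaleDr : right_distributive realified_scale +%R.
Proof. by move=> a x y; rewrite /realified_scale scalerDr. Qed.

Fact realified_scaleDl x : {morph realified_scale^~ x : a b / a + b}.
Proof. by move=> a b; rewrite /realified_scale rmorphD scalerDl. Qed.

HB.instance Definition _ := GRing.Zmodule_isLmodule.Build R (realified E)
  realified_scaleA realified_scale1 realified_scaleDr realified_scaleDl.

End realified.

Section complexification.
Variables (R : realType) (E : normedModType R[i]).

Definition real_norm (x : realified E) : R := complex.Re `|x : E|.

Lemma real_normE (x : E) : (real_norm x)%:C = `|x|.
Proof. by apply/RRe_real; rewrite realE normr_ge0. Qed.

Lemma real_norm_seminorm : seminorm real_norm.
Proof.
split=> [x y|a x].
  by rewrite -lecR rmorphD /= !real_normE; exact: ler_normD.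
apply: complexI; rewrite rmorphM /= !real_normE -normC_real.
exact: (normrZ (a%:C) (x : E)).
Qed.

Lemma Re_continuous : continuous (fun z : R[i]^o => complex.Re z : R).
Proof.
move=> z; apply/(@cvgrPdist_lt _ _ _ (nbhs (z : R[i]^o))) => eps eps0.
have := nbhsx_ballx (z : R[i]^o) (eps%:C : R[i]).
rewrite ltcR -ball_normE => /(_ eps0).
apply: filterS => w; rewrite -ltcR; apply: le_lt_trans.
by have := normc_ge_Re (z - w); rewrite raddfB.
Qed.

(** A real functional [f] is the real part of the complex linear functional
    [x |-> f x - i f (i x)]. *)
Lemma real_dual_weakly_continuous (f : realified E -> R) :
  dual_ball real_norm f -> continuous (f : weak E -> R).
Proof.
move=> fN.
pose g (x : E) : R[i]^o := Complex (f x) (- f ('i *: x)).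
have fZ (a : R) (x : E) : f (a%:C *: x) = a * f x.
  exact: (dual_ballZ a (x : realified E) fN).
have fD (x y : E) : f (x + y) = f x + f y.
  exact: (dual_ballD (x : realified E) (y : realified E) fN).
have fNn (x : E) : f (- x) = - f x.
  exact: (dual_ballN (x : realified E) fN).
have glin : linear g.
  case=> a b x y; rewrite /g.
  have -> : (a +i* b)%C *: x = a%:C *: x + b%:C *: ('i *: x).
    rewrite scalerA -scalerDl; congr (_ *: _).
    by apply/eqP; rewrite eq_complex /=; simpc.
  have -> : 'i *: (a%:C *: x + b%:C *: ('i *: x) + y) =
      a%:C *: ('i *: x) - b%:C *: x + 'i *: y.
    rewrite !scalerDr !scalerA -scaleNr; congr (_ *: _ + _ *: _ + _).
      by apply/eqP; rewrite eq_complex /=; simpc.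
    by apply/eqP; rewrite eq_complex /=; simpc.
  rewrite !fD !fNn !fZ.
  apply/eqP; rewrite eq_complex /=; apply/andP; split; apply/eqP; ring.
have fle (x : E) : `|f x| <= real_norm x.
  rewrite ler_norml fN.2 andbT.
  by have := dual_ball_ge (x : realified E) fN; rewrite (seminormN real_norm_seminorm).
have iN (x : E) : real_norm ('i *: x) = real_norm x.
  by apply: complexI; rewrite !real_normE normrZ normCi mul1r.
have gN x : `|g x| <= 2 * `|x|.
  have -> : g x = (f x)%:C - 'i%C * (f ('i *: x))%:C.
    by apply/eqP; rewrite eq_complex /=; simpc.
  apply: le_trans (ler_normB _ _) _.
  rewrite normrM normCi mul1r !normC_real -real_normE mulr_natl mulr2n.
  by rewrite lerD// lecR// -[real_norm x]iN.
have gc := bounded_linear_weakly_continuous glin (ltr0n _ 2) gN.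
move=> x; apply: (@continuous_comp (weak E) R[i]^o R g (@complex.Re R)).
  exact: gc.
exact: Re_continuous.
Qed.

End complexification.

Proposition complex_fixed_point_property (R : realType)
    (S : semitopologicalSemigroupType) :
  (exists m : (S -> R[i]^o) -> R[i], left_invariant_mean (LUC R S) m) ->
  fixed_point_property S R[i].
Proof.
move=> lim E K act K0 Kc Kconv [actK actA] actC actN.
have := @abstract_common_fixed_point R S (realified E) (@real_norm R E)
  (weak E) id K act.
apply => //.
- exact: real_norm_seminorm.
- move=> x x0; apply/eqP; rewrite -(normr_eq0 (x : E)) -real_normE.
  by rewrite x0.
- exact: real_dual_weakly_continuous.
- move=> u v t Ku Kv /andP[t0 t1].
  exists (t%:C *: (u : E) + (1 - t%:C) *: (v : E)).
    by apply: convex_set_segment => //; rewrite ler0c t0 /= -[1]/(1%:C) lecR.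
  by rewrite -[1]/(1%:C) -rmorphB.
- move=> s x y Kx Ky; rewrite -lecR !real_normE; exact: actN.
Qed.

Theorem theorem3p4 (R : realType) (S : semitopologicalSemigroupType) :
  (exists m : (S -> R[i]^o) -> R[i], left_invariant_mean (LUC R S) m) ->
  fixed_point_property S R /\ fixed_point_property S R[i].
Proof.
move=> lim; split.
  exact: real_fixed_point_property.
exact: complex_fixed_point_property.
Qed.
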